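(* Let $f\in\mathrm{LC}$ satisfy (A$_1$), (A$_2$), and (A$_3$) the fundamental matrix $\Phi$ of $\dot y=A(t)y$ with $\Phi(0)=I_N$ satisfies $\|\Phi(t)\Phi^{-1}(s)\|\le Ke^{-\alpha_1(t-s)}$ for $s\le t\le0$, for some $\alpha_1>0$, $K\ge1$; (A$_4$) $\sup_{t\in\mathbb R}\int_{-r}^r|b(s+t)|ds<\infty$ for every $r>0$. Then the process $S_f$ on $(\mathbb R^N)^+$ given by $S_f(t,s)x_0=x(t,f,s,x_0)$ is strongly pullback bounded dissipative on $(-\infty,\tau]$ for every $\tau\in\mathbb R$, and consequently it has a pullback attractor which is bounded in the past (i.e. $\bigcup_{t\le\tau}\mathcal A(t)$ is bounded for every $\tau$).
   Context: $\mathrm{LC}$: Borel measurable $f:\mathbb R\times\mathbb R^N\to\mathbb R^N$ such that for every compact $K$ there are $m^K,l^K\in L^1_{loc}$ with $|f(t,x)|\le m^K(t)$ and $|f(t,x)-f(t,y)|\le l^K(t)|x-y|$ for $x,y\in K$, a.e. $t$. $x(t,f,s,x_0)$ is the solution of $\dot x=f(t,x)$, $x(s)=x_0$. For $x\in\mathbb R^N$, $x\ge0$ means all components $x_i\ge0$; $(\mathbb R^N)^+=\{x\ge0\}$; vector inequalities are componentwise. (A$_1$): if $x\ge0$ and $x_i=0$, then $f_i(t,x)\ge0$ for a.e. $t$. (A$_2$): for a.e. $(t,x)\in\mathbb R\times(\mathbb R^N)^+$, $f(t,x)\le A(t)x+b(t)$, where $A=[a_{ij}]\in L^1_{loc}(\mathbb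 R^{N\times N})$ with $a_{ij}\ge0$ for $i\ne j$, and $b\in L^1_{loc}(\mathbb R^N)$ with $b(t)\ge0$ for all $t$. Under (A$_1$),(A$_2$), solutions with $x_0\in(\mathbb R^N)^+$ remain nonnegative and exist for all forward times, so $S_f$ is a process on $(\mathbb R^N)^+$. A family $\{B(t)\}_{t\in\mathbb R}$ of nonempty bounded sets is pullback absorbing for $S$ if for every $t$ and bounded $D$ there is $T(t,D)>0$ with $S(t,t-s)D\subset B(t)$ for $s\ge T(t,D)$. $S$ is strongly pullback bounded dissipative on $(-\infty,\tau]$ if there is a pullback absorbing family $\{B(t)\}$ such that for each bounded $D$ there is $T(\tau,D)>0$ with $S(t,t-s)D\subset B(\tau)$ for all $t\le\tau$, $s\ge T(\tau,D)$. A pullback attractor of a process $S$ is a family $\{\mathcal A(t)\}_{t\in\mathbb R}$ of compact sets with $S(t,s)\mathcal A(s)=\mathcal A(t)$ for $t\ge s$, $\lim_{s\to-\infty}\mathrm{dist}(S(t,s)D,\mathcal A(t))=0$ for every bounded $D$ and $t$ (Hausdorff semi-distance), and minimal among closed families with this property. *)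

(* Defs.v *)
From HB Require Import structures.
From mathcomp Require Import all_boot all_order all_algebra.
From mathcomp Require Import all_classical all_reals all_analysis.
Set Implicit Arguments. Unset Strict Implicit. Unset Printing Implicit Defensive.
Import Order.TTheory GRing.Theory Num.Theory.
Import numFieldNormedType.Exports.
Local Open Scope classical_set_scope.
Local Open Scope ring_scope.

Section Defs.
Variable R : realType.
Variable N : nat.
Local Notation vec := 'cV[R]_N.
Local Notation mu := (@lebesgue_measure R).

Definition comp (x : vec) (i : 'I_N) : R := x i ord0.

Definition vle (x y : vec) : Prop := forall i, comp x i <= comp y i.
Definition cone : set vec := [set x | forall i, 0 <= comp x i].

Definition integrable_on (a b : R) (g : R -> R) : Prop :=
  mu.-integrable `[Num.min a b, Num.max a b] (EFin \o g).

Definition oint (a b : R) (g : R -> R) : R :=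
  if a <= b then Rintegral mu `[a, b] g else - Rintegral mu `[b, a] g.

Definition L1loc (g : R -> R) : Prop := locally_integrable setT g.
Definition L1loc_vec (g : R -> vec) : Prop :=
  forall i, L1loc (fun t => comp (g t) i).
Definition L1loc_mx (g : R -> 'M[R]_N) : Prop :=
  forall i j, L1loc (fun t => g t i j).

Definition borel_measurable (f : R -> vec -> vec) : Prop :=
  forall (i : 'I_N) (U : set R), open U ->
    <<s [set V : set (R * vec) | open V] >>
      ((fun p : R * vec => comp (f p.1 p.2) i) @^-1` U).

Definition bounded (D : set vec) : Prop :=
  exists M : R, forall x, D x -> `|x| <= M.

Definition LC (f : R -> vec -> vec) : Prop :=
  borel_measurable f /\
  forall K : set vec, compact K ->
    exists m l : R -> R, L1loc m /\ L1loc l /\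
      {ae mu, forall t, forall x y, K x -> K y ->
          `|f t x| <= m t /\ `|f t x - f t y| <= l t * `|x - y| }.

(* Lebesgue null sets of R x R^N = R^(N+1): coverable by countably many
   closed boxes of arbitrarily small total volume *)
Definition box (a0 b0 : R) (a b : vec) : set (R * vec) :=
  [set p | a0 <= p.1 <= b0 /\ forall i, comp a i <= comp p.2 i <= comp b i].
Definition box_vol (a0 b0 : R) (a b : vec) : R :=
  (b0 - a0) * \prod_(i < N) (comp b i - comp a i).
Definition null_prod (E : set (R * vec)) : Prop :=
  forall eps : R, 0 < eps ->
    exists (a0 b0 : nat -> R) (a b : nat -> vec),
      (forall k, a0 k <= b0 k /\ vle (a k) (b k)) /\
      E `<=` \bigcup_k box (a0 k) (b0 k) (a k) (b k) /\
      forall n, \sum_(k < n) box_vol (a0 k) (b0 k) (a k) (b k) <= eps.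

Definition A1 (f : R -> vec -> vec) : Prop :=
  forall x i, cone x -> comp x i = 0 ->
    {ae mu, forall t, 0 <= comp (f t x) i}.

Definition A2 (f : R -> vec -> vec) (A : R -> 'M[R]_N) (b : R -> vec) : Prop :=
  L1loc_mx A /\ (forall t i j, i != j -> 0 <= A t i j) /\
  L1loc_vec b /\ (forall t, cone (b t)) /\
  exists E, null_prod E /\
    forall t x, cone x -> ~ E (t, x) -> vle (f t x) (A t *m x + b t).

(* Phi is the fundamental matrix of y' = A(t) y with Phi(0) = I
   (Caratheodory sense: Phi(t) = I + \int_0^t A(r) Phi(r) dr) *)
Definition fundamental_matrix (A : R -> 'M[R]_N) (Phi : R -> 'M[R]_N) : Prop :=
  forall t i j, integrable_on 0 t (fun r => (A r *m Phi r) i j) /\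
    Phi t i j = (1%:M : 'M[R]_N) i j + oint 0 t (fun r => (A r *m Phi r) i j).

Definition A3 (A : R -> 'M[R]_N) : Prop :=
  exists (alpha1 K : R), 0 < alpha1 /\ 1 <= K /\
    forall Phi, fundamental_matrix A Phi ->
      forall s t, s <= t -> t <= 0 ->
        `|Phi t *m invmx (Phi s)| <= K * expR (- alpha1 * (t - s)).

Definition A4 (b : R -> vec) : Prop :=
  forall r : R, 0 < r -> exists M : R, forall t : R,
    Rintegral mu `[- r, r] (fun s => `|b (s + t)|) <= M.

(* x : R -> R^N is a (Caratheodory) solution of x' = f(t,x), x(s) = x0 on
   [s, +oo) *)
Definition is_solution (f : R -> vec -> vec) (s : R) (x0 : vec) (x : R -> vec)
  : Prop :=
  forall t, s <= t -> forall i,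
    integrable_on s t (fun r => comp (f r (x r)) i) /\
    comp (x t) i = comp x0 i + oint s t (fun r => comp (f r (x r)) i).

Definition is_solution_process (f : R -> vec -> vec) (S : R -> R -> vec -> vec)
  : Prop :=
  forall s x0, cone x0 -> is_solution f s x0 (fun t => S t s x0).

Definition pullback_absorbing (S : R -> R -> vec -> vec) (B : R -> set vec)
  : Prop :=
  (forall t, B t !=set0 /\ bounded (B t) /\ B t `<=` cone) /\
  forall t D, D `<=` cone -> bounded D ->
    exists T, 0 < T /\ forall s, T <= s -> S t (t - s) @` D `<=` B t.

Definition strongly_pullback_bounded_dissipative (S : R -> R -> vec -> vec)
  (tau : R) : Prop :=
  exists B, pullback_absorbing S B /\
    forall D, D `<=` cone -> bounded D ->
      exists T, 0 < T /\ forall t s, t <= tau -> T <= s ->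
        S t (t - s) @` D `<=` B tau.

Definition hsemidist (X Y : set vec) : \bar R :=
  ereal_sup [set ereal_inf [set (`|x - y|)%:E | y in Y] | x in X].

Definition pullback_attracting (S : R -> R -> vec -> vec) (C : R -> set vec)
  : Prop :=
  forall t D, D `<=` cone -> bounded D ->
    forall e : R, 0 < e -> exists s0 : R, forall s, s <= s0 -> s <= t ->
      (hsemidist (S t s @` D) (C t) <= e%:E)%E.

Definition pullback_attractor (S : R -> R -> vec -> vec) (A : R -> set vec)
  : Prop :=
  (forall t, compact (A t) /\ A t `<=` cone) /\
  (forall t s, s <= t -> S t s @` A s = A t) /\
  pullback_attracting S A /\
  (forall C : R -> set vec, (forall t, closed (C t) /\ C t `<=` cone) ->
     pullback_attracting S C -> forall t, A t `<=` C t).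

Definition bounded_in_the_past (A : R -> set vec) : Prop :=
  forall tau : R, bounded (\bigcup_(t in [set t | t <= tau]) A t).

End Defs.

(* Main.v *)
Require Import Defs.
From HB Require Import structures.
From mathcomp Require Import all_boot all_order all_algebra.
From mathcomp Require Import all_classical all_reals all_analysis.
From mathcomp Require Import measurable_realfun ring lra.
Import Order.TTheory GRing.Theory Num.Theory.
Import numFieldNormedType.Exports.
Local Open Scope classical_set_scope.
Local Open Scope ring_scope.

Set Implicit Arguments.
Unset Strict Implicit.
Unset Printing Implicit Defensive.

(** Solutions of [x' = f(t, x)] started in the cone stay there by (A1), so (A2)
and the sign of the off-diagonal entries of [A] give
[x(t) <= U(t, s) x(s) + C int_s^t |b|] for the transition matrix [U] of
[y' = A(t) y].  Applied on intervals of length one, (A3) turns the accumulated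
error into a geometric series controlled by (A4), hence
[|x(t)| <= c exp(- al (t - s)) |x(s)| + rho] for all [s <= t <= tau]: this is
strong dissipativity.  If [B0] is a compact set absorbing every bounded set
uniformly on [(-oo, 0]], the attractor is the intersection over
[s <= min(t, 0)] of the eventually nested compact sets [S(t, s) B0].

The data are only integrable in time, so no chain rule is used.  Gronwall
estimates, positivity, comparison and existence for the linear equation are all
proved on intervals where the integral of the Lipschitz weight is at most [1/2],
by comparing a supremum with half of itself, and are then propagated by Cousin's
lemma.  The exceptional set in (A2) is null in [R x R^N]; slicing its covers by
boxes shows that for almost every [t] the slice has dense complement, and the
inequality extends to the whole cone by continuity of [f(t, .)]. *)

(** * Almost-everywhere statements and integrals over segments *)

Section segment_integral.
Context {R : realType}.
Local Notation mu := (@lebesgue_measure R).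
Implicit Types (a b c t : R) (g h l : R -> R).

(** The number of small steps given by Cousin's lemma is uncontrolled, so a comparison must not lose
    a factor at each of them. The inequality on [[u, w]] is therefore propagated only after
    transport by the nonnegative matrix [U T w] to a common later time [T]. There the errors simply
    add, and each pays the bound on [U] once. Keeping the decay of [U] in the same device turns the
    unit steps into a geometric series. Comparing a supremum with half of itself is conclusive only
    if the supremum is finite; this is why boundedness accompanies every estimate. It comes for
    free, since solutions are primitives of integrable functions. (A1) gives a null set of times for
    each state, whereas a solution visits uncountably many states. Rational states and integer radii
    leave countably many null sets, and the Lipschitz bounds do the rest. The nonlinear solutions
    are given; the composition law of [S] and its continuity in the state are consequences of
    Gronwall's estimate. *)

Lemma ae_imply (P Q : R -> Prop) : (forall t, P t -> Q t) ->
  {ae mu, forall t, P t} -> {ae mu, forall t, Q t}.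
Proof.
by move=> PQ; apply: (@filterS _ _ (ae_filter_ringOfSetsType mu)) => t /PQ.
Qed.

Lemma ae_and (P Q : R -> Prop) : {ae mu, forall t, P t} ->
  {ae mu, forall t, Q t} -> {ae mu, forall t, P t /\ Q t}.
Proof.
by move=> aP aQ; exact: (@filterI _ _ (ae_filter_ringOfSetsType mu) _ _ aP aQ).
Qed.

Definition sintegrable a b g := mu.-integrable `[a, b] (EFin \o g).

(** Not oriented, in contrast to [oint]: for [b < a] the segment is empty and the value is 0. *)
Definition sint a b g : R := Rintegral mu `[a, b] g.

Lemma L1loc_sintegrable g a b : L1loc g -> sintegrable a b g.
Proof.
move=> [mg _ gfin]; apply/integrableP; split.
  by apply/measurable_EFinP; exact: measurable_funTS.
by apply: gfin => //; exact: segment_compact.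
Qed.

Lemma L1loc_norm g : L1loc g -> L1loc (fun t => `|g t|).
Proof.
move=> [mg o gfin]; split => //; first exact: measurableT_comp.
by move=> K KT cK; under eq_integral do rewrite normr_id; exact: gfin.
Qed.

Lemma L1loc0 : L1loc (fun _ : R => 0 : R).
Proof.
split=> //; first exact: openT.
by move=> K _ cK; under eq_integral do rewrite normr0; rewrite integral0.
Qed.

Lemma L1loc_sum (I : Type) (s : seq I) (g : I -> R -> R) :
  (forall i, L1loc (g i)) -> L1loc (fun t => \sum_(i <- s) g i t).
Proof.
move=> Lg; elim: s => [|i s IH].
  by under eq_fun do rewrite big_nil; exact: L1loc0.
under eq_fun do rewrite big_cons.
exact: (locally_integrableD (Lg i) IH).
Qed.

Lemma sintegrableS a b c d g : a <= c -> d <= b ->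
  sintegrable a b g -> sintegrable c d g.
Proof.
move=> ac db; apply: integrableS => //.
by apply: subset_itv; rewrite bnd_simp.
Qed.

Lemma sintegrable_norm a b g : sintegrable a b g ->
  sintegrable a b (fun t => `|g t|).
Proof. exact: integrable_norm. Qed.

Lemma sintegrableD a b g h : sintegrable a b g -> sintegrable a b h ->
  sintegrable a b (fun t => g t + h t).
Proof. by move=> ig ih; exact: (integrableD _ ig ih). Qed.

Lemma sintegrableB a b g h : sintegrable a b g -> sintegrable a b h ->
  sintegrable a b (fun t => g t - h t).
Proof. by move=> ig ih; exact: (integrableB _ ig ih). Qed.

Lemma sintegrableZl a b g k : sintegrable a b g ->
  sintegrable a b (fun t => k * g t).
Proof. by move=> ig; exact: (integrableZl _ k ig). Qed.

Lemma sintegrable_sum a b (I : Type) (s : seq I) (g : I -> R -> R) :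
  (forall i, sintegrable a b (g i)) ->
  sintegrable a b (fun t => \sum_(i <- s) g i t).
Proof.
move=> Lg; elim: s => [|i s IH].
  under eq_fun do rewrite big_nil.
  by apply: (@eq_integrable _ _ _ _ _ _ (cst 0%E)) => //; exact: integrable0.
under eq_fun do rewrite big_cons.
exact: (sintegrableD (Lg i) IH).
Qed.

Lemma sint_split a b c g : a <= c -> c <= b -> sintegrable a b g ->
  sint a b g = sint a c g + sint c b g.
Proof.
move=> ac cb ig; rewrite /sint; apply/eqP; rewrite addrC -subr_eq; apply/eqP.
rewrite (Rintegral_itvB ig) ?bnd_simp//.
rewrite Rintegral_itv_obnd_cbnd//; apply: integrableS ig => //.
by apply: subset_itvr; rewrite bnd_simp.
Qed.

Lemma sint_refl a g : sint a a g = 0.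
Proof. by rewrite /sint set_itv1 Rintegral_set1. Qed.

Lemma sintD a b g h : sintegrable a b g -> sintegrable a b h ->
  sint a b (fun t => g t + h t) = sint a b g + sint a b h.
Proof. by move=> ig ih; exact: RintegralD. Qed.

Lemma sintB a b g h : sintegrable a b g -> sintegrable a b h ->
  sint a b (fun t => g t - h t) = sint a b g - sint a b h.
Proof. by move=> ig ih; exact: RintegralB. Qed.

Lemma sintZl a b g k : sintegrable a b g ->
  sint a b (fun t => k * g t) = k * sint a b g.
Proof. by move=> ig; exact: RintegralZl. Qed.

Lemma sint_norm a b g : sintegrable a b g ->
  `|sint a b g| <= sint a b (fun t => `|g t|).
Proof. by move=> ig; exact: le_normr_Rintegral. Qed.

Lemma sint_ge0 a b g : (forall t, 0 <= g t) -> 0 <= sint a b g.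
Proof. by move=> g0; apply: Rintegral_ge0. Qed.

Lemma sint_subset a b c d g : (forall t, 0 <= g t) -> a <= c -> c <= d ->
  d <= b -> sintegrable a b g -> sint c d g <= sint a b g.
Proof.
move=> g0 ac cd db ig.
rewrite (sint_split (c := c) _ _ ig)//; last exact: le_trans db.
rewrite (@sint_split c b d)//; last exact: sintegrableS ig.
by rewrite addrCA lerDl addr_ge0// sint_ge0.
Qed.

Lemma ae_le_sint a b g h : sintegrable a b g -> sintegrable a b h ->
  {ae mu, forall t, a <= t <= b -> g t <= h t} -> sint a b g <= sint a b h.
Proof.
move=> ig ih gh; rewrite -subr_ge0 -sintB//.
(* Almost everywhere the difference equals its positive part, which is nonnegative without any
   exception. *)
have -> : sint a b (fun t => h t - g t) =
    sint a b (fun t => Num.max (h t - g t) 0).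
  rewrite /sint /Rintegral; congr fine.
  have mhg : measurable_fun `[a, b] (fun t => h t - g t).
    by apply: measurable_funB;
      [case/integrableP : ih|case/integrableP : ig] => /measurable_EFinP.
  apply: ae_eq_integral => //.
  - exact/measurable_EFinP.
  - by apply/measurable_EFinP; apply: measurable_maxr.
  - apply: ae_imply gh => t gh /=; rewrite in_itv/= => /gh gh'.
    by rewrite max_l// subr_ge0.
by apply: sint_ge0 => t; rewrite le_max lexx orbT.
Qed.

Lemma le_sint a b g h : sintegrable a b g -> sintegrable a b h ->
  (forall t, a <= t <= b -> g t <= h t) -> sint a b g <= sint a b h.
Proof. by move=> ig ih gh; apply: ae_le_sint => //; exact: aeW. Qed.

Lemma eq_sint a b g h : (forall t, a <= t <= b -> g t = h t) ->
  sint a b g = sint a b h.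
Proof.
by move=> gh; apply: eq_Rintegral => t; rewrite inE/= in_itv/=; exact: gh.
Qed.

Lemma eq_sintegrable a b g h : (forall t, a <= t <= b -> g t = h t) ->
  sintegrable a b g -> sintegrable a b h.
Proof.
move=> gh; apply: eq_integrable => // t.
by rewrite inE/= in_itv/= => /gh ->.
Qed.

Lemma sint_continuous a b g : a <= b -> sintegrable a b g ->
  {within `[a, b], continuous (fun t => sint a t g)}.
Proof. by move=> ab ig; exact: parameterized_integral_continuous. Qed.

(** The primitive of [l] is continuous at [t]; both ends of the short segment are within [e / 2] of
    its value there. This provides the gauge for Cousin's lemma. *)
Lemma sint_small l t e : L1loc l -> (forall r, 0 <= l r) -> 0 < e ->
  exists2 d, 0 < d & forall u v, u <= v -> t - d <= u -> v <= t + d ->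
    sint u v l <= e.
Proof.
move=> Ll l0 e0; pose a := t - 1; pose b := t + 1.
have ab : a <= b by rewrite /a /b; lra.
have il := @L1loc_sintegrable l a b Ll.
have /subspace_continuousP/(_ t) := sint_continuous ab il.
have tab : `[a, b]%classic t by rewrite /= in_itv/= /a /b; apply/andP; split; lra.
move=> /(_ tab)/cvgrPdist_lt /(_ (e / 2)).
have e20 : 0 < e / 2 by rewrite divr_gt0.
move=> /(_ e20); rewrite /dnbhs /within /= -/(nbhs _ _) => /nbhs_ballP[d /= d0 dP].
(* Halving [d] gives room for weak inequalities, and [1] keeps the points inside [[a, b]]. *)
pose d' := Num.min (d / 2) 1.
have d'0 : 0 < d' by rewrite /d' lt_min divr_gt0//=.
have d'1 : d' <= 1 by rewrite /d' ge_min lexx orbT.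
have d'd : d' < d by rewrite /d' gt_min; apply/orP; left; lra.
have close r : t - d' <= r -> r <= t + d' ->
    `|sint a t l - sint a r l| < e / 2.
  move=> r1 r2; apply: dP.
    rewrite /ball/= ltr_distlC; apply/andP; split; lra.
  by rewrite /= in_itv/= /a /b; apply/andP; split; lra.
exists d' => // u v uv tu vt.
have iv : sintegrable a v l by exact: L1loc_sintegrable.
have := sint_split (a := a) (c := u) (b := v) _ uv iv.
move=> /(_ ltac:(rewrite /a; lra)) E.
have := close u ltac:(lra) ltac:(lra).
have := close v ltac:(lra) ltac:(lra).
by rewrite !ltr_distl => /andP[? ?] /andP[? ?]; lra.
Qed.

End segment_integral.

(** * Cousin's lemma and propagation along small steps *)

Section cousin.
Context {R : realType}.
Implicit Types (Q : R -> R -> Prop).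

(** The local property at the supremum of the reachable points links a reachable point just before
    it to a point beyond it, unless the supremum is [b]. *)
Lemma cousin Q (a b : R) : a <= b ->
  (forall t, a <= t <= b -> exists2 d, 0 < d & forall u v, a <= u -> u <= v ->
     v <= b -> t - d <= u -> v <= t + d -> Q u v) ->
  (forall u v w, a <= u -> u <= v -> v <= w -> w <= b ->
     Q u v -> Q v w -> Q u w) ->
  Q a b.
Proof.
move=> ab loc tr.
pose E := [set v | a <= v <= b /\ Q a v].
have Ea : E a.
  have [d d0 dP] := loc a ltac:(rewrite lexx ab//).
  by split; [rewrite lexx ab|apply: dP => //; lra].
have supE : has_sup E.
  by split; [exists a|exists b => v [/andP[]]].
have aS : a <= sup E by apply: (ub_le_sup supE.2).
have Sb : sup E <= b.
  by apply: ge_sup; [exists a|move=> v [/andP[]]].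
have [d d0 dP] := loc (sup E) ltac:(rewrite aS Sb//).
have [v [/andP[av vb] Qav] vS] := sup_adherent d0 supE.
have vE : v <= sup E by apply: (ub_le_sup supE.2); split => //; rewrite av vb.
pose w := Num.min b (sup E + d).
have wb : w <= b by rewrite /w ge_min lexx.
have wS : w <= sup E + d by rewrite /w ge_min lexx orbT.
have Sw : sup E <= w by rewrite /w le_min Sb lerDl ltW.
have Qvw : Q v w by apply: dP => //; lra.
have Qaw : Q a w by apply: tr Qav Qvw => //; lra.
have wE : w <= sup E.
  by apply: (ub_le_sup supE.2); split => //; apply/andP; split; lra.
move: Qaw; rewrite (_ : w = b)//.
by rewrite /w; case: (leP b (sup E + d)) => // h; move: wE; rewrite /w min_r; lra.
Qed.

Lemma small_steps Q (l : R -> R) (k a b : R) : 0 < k -> L1loc l ->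
  (forall t, 0 <= l t) -> a <= b ->
  (forall u v, a <= u -> u <= v -> v <= b -> sint u v l <= k -> Q u v) ->
  (forall u v w, a <= u -> u <= v -> v <= w -> w <= b ->
     Q u v -> Q v w -> Q u w) ->
  Q a b.
Proof.
move=> k0 Ll l0 ab loc tr; apply: cousin => // t _.
have [d d0 dP] := sint_small t Ll l0 k0.
by exists d => // u v au uv vb tu vt; apply: loc => //; exact: dP.
Qed.

End cousin.

(** * Entrywise bounds for the maximum norm of matrices *)

Section matrix_norm.
Context {R : realType}.

Lemma mx_norm_le m n (M : 'M[R]_(m, n)) c : 0 <= c ->
  (forall i j, `|M i j| <= c) -> `|M| <= c.
Proof.
move=> c0 Mc; rewrite [leLHS]/Num.Def.normr/= mx_normrE.
by apply: bigmax_le => // -[i j] _ /=.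
Qed.

Lemma mx_entry_le m n (M : 'M[R]_(m, n)) i j : `|M i j| <= `|M|.
Proof.
rewrite [leRHS]/Num.Def.normr/= mx_normrE.
by apply/bigmax_geP; right; exists (i, j).
Qed.

Lemma mulmx_entry_le m n p (M : 'M[R]_(m, n)) (P : 'M[R]_(n, p)) i j :
  `|(M *m P) i j| <= (\sum_k `|M i k|) * `|P|.
Proof.
rewrite mxE mulr_suml; apply: le_trans (ler_norm_sum _ _ _) _.
by apply: ler_sum => k _; rewrite normrM ler_wpM2l// mx_entry_le.
Qed.

(** The maximum norm is not submultiplicative; the factors [N%:R] in later constants originate
    here. *)
Lemma mulmx_norm_le m n p (M : 'M[R]_(m, n)) (P : 'M[R]_(n, p)) :
  `|M *m P| <= n%:R * `|M| * `|P|.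
Proof.
apply: mx_norm_le => [|i j]; first by rewrite !mulr_ge0.
apply: le_trans (mulmx_entry_le _ _ _ _) _; rewrite ler_wpM2r//.
rewrite -[n in n%:R]card_ord -sum1_card natr_sum mulr_suml ler_sum// => k _.
by rewrite mul1r mx_entry_le.
Qed.

End matrix_norm.

(** * Estimates by half of a supremum, and Gronwall's inequality *)

Section sup_arguments.
Context {R : realType}.

(** Continuity makes the supremum of the nonpositive times before [t] one of them. Increments then
    need an estimate only where the function is positive. *)
Lemma last_nonpositive (h : R -> R) (a b t : R) :
  {within `[a, b], continuous h} -> h a <= 0 -> a <= t -> t <= b ->
  0 < h t ->
  exists s, [/\ a <= s, s < t, h s <= 0 & forall r, s < r <= t -> 0 < h r].
Proof.
move=> ch ha at_ tb ht.
pose E := [set r | a <= r <= t /\ h r <= 0].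
have Ea : E a by split => //; rewrite lexx at_.
have supE : has_sup E by split; [exists a|exists t => v [/andP[]]].
have aS : a <= sup E by apply: (ub_le_sup supE.2).
have St : sup E <= t by apply: ge_sup; [exists a|move=> v [/andP[]]].
have hS : h (sup E) <= 0.
  rewrite leNgt; apply/negP => hS.
  have sab : `[a, b]%classic (sup E).
    by rewrite /= in_itv/= aS (le_trans St).
  have /subspace_continuousP/(_ _ sab)/cvgrPdist_lt/(_ _ hS) := ch.
  rewrite /within /= => /nbhs_ballP[d /= d0 dP].
  have [r [/andP[ar rt] hr] rS] := sup_adherent d0 supE.
  have rE : r <= sup E by apply: (ub_le_sup supE.2); split => //; rewrite ar rt.
  have br : ball (sup E) d r.
    by rewrite /ball/= ltr_distlC; apply/andP; split; lra.
  have : `|h (sup E) - h r| < h (sup E).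
    by apply: dP => //; rewrite in_itv/= ar (le_trans rt tb).
  by rewrite ltr_distlC => /andP[? ?]; lra.
exists (sup E); split => //.
  rewrite lt_neqAle St andbT; apply/eqP => Ste; move: hS; rewrite Ste; lra.
move=> r /andP[Sr rt]; rewrite ltNge; apply/negP => hr.
suff : r <= sup E by rewrite leNgt Sr.
by apply: (ub_le_sup supE.2); split => //; rewrite rt (le_trans aS (ltW Sr)).
Qed.

Lemma one_sided_bound n (v : R -> 'I_n -> R) (a b be k : R) : a <= b ->
  0 <= be -> k <= 1 / 2 ->
  (forall i, {within `[a, b], continuous (fun t => v t i)}) ->
  (forall i, v a i <= 0) ->
  (forall m i s t, 0 <= m -> a <= s -> s <= t -> t <= b ->
     (forall j r, a <= r <= b -> v r j <= m) ->
     (forall r, s < r <= t -> 0 < v r i) -> v t i - v s i <= m * k + be) ->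
  forall t i, a <= t <= b -> v t i <= 2 * be.
Proof.
move=> ab be0 k2 cv va inc t0 i0 t0ab.
(* Adjoining [0] makes [sup E] nonnegative, as [inc] demands, even if all components are
   negative. *)
pose E := [set x | exists2 t, a <= t <= b & exists i, x = v t i] `|` [set 0].
have E0 : E 0 by right.
have ubE : has_ubound E.
  have /choice[c cP] i : exists c, forall t, a <= t <= b -> v t i <= c.
    have [c _ cP] := EVT_max ab (cv i).
    by exists (v c i) => t tab; apply: cP; rewrite in_itv/=.
  exists (\big[Num.max/0]_i c i) => _ [[t tab [i ->]]|->].
    by apply: le_trans (cP i t tab) _; apply: le_bigmax.
  exact: bigmax_ge_id.
have m0 : 0 <= sup E by apply: ub_le_sup.
have vm j r : a <= r <= b -> v r j <= sup E.
  by move=> rab; apply: ub_le_sup => //; left; exists r => //; exists j.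
have mk : sup E * k <= sup E / 2 by rewrite ler_wpM2l//; lra.
have : sup E <= sup E / 2 + be.
  apply: ge_sup; first by exists 0.
  move=> _ [[t /andP[at_ tb] [i ->]]|->]; last by rewrite addr_ge0// divr_ge0.
  have [v0|v0] := leP (v t i) 0.
    by apply: le_trans v0 _; rewrite addr_ge0// divr_ge0.
  have [s [as_ st vs pos]] := last_nonpositive (cv i) (va i) at_ tb v0.
  have := inc _ i s t m0 as_ (ltW st) tb vm pos; lra.
by have := vm i0 t0 t0ab; lra.
Qed.

Context {m p : nat}.
Implicit Types (v : R -> 'M[R]_(m, p)) (l : R -> R).

(** The trace left on [v] by a Lipschitz equation of weight [l], stated without the equation so that
    it covers linear solutions as well as differences of nonlinear ones. *)
Definition controlled l (a b : R) v :=
  (exists M, forall r, a <= r <= b -> `|v r| <= M) /\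
  forall u w M, a <= u -> u <= w -> w <= b -> 0 <= M ->
    (forall r, u <= r <= w -> `|v r| <= M) ->
    forall t c, u <= t -> t <= c -> c <= w -> `|v c - v t| <= M * sint u w l.

Lemma controlledS l a b c d v : a <= c -> d <= b -> controlled l a b v ->
  controlled l c d v.
Proof.
move=> ac db [[M vM] vi]; split.
  by exists M => r /andP[cr rd]; apply: vM; rewrite (le_trans ac)// (le_trans rd).
by move=> u w M' cu uw wd; apply: vi => //; [exact: le_trans cu|exact: le_trans db].
Qed.

Lemma controlled_local l a b v : a <= b -> sint a b l <= 1 / 2 ->
  controlled l a b v ->
  forall t c, a <= t <= b -> a <= c <= b -> `|v t| <= 2 * `|v c|.
Proof.
move=> ab l2 [[M vM] vi] t0 c t0ab cab.
pose E := [set `|v r| | r in [set r | a <= r <= b]].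
have Ec : E `|v c| by exists c.
have ubE : has_ubound E by exists M => _ [r rab <-]; exact: vM.
have vm r : a <= r <= b -> `|v r| <= sup E.
  by move=> rab; apply: ub_le_sup => //; exists r.
have m0 : 0 <= sup E by apply: le_trans (vm _ cab).
have mk : sup E * sint a b l <= sup E / 2 by rewrite ler_wpM2l//; lra.
have inc r : a <= r <= b -> `|v r - v c| <= sup E / 2.
  move=> /andP[ar rb]; have /andP[ac cb] := cab; apply: le_trans mk.
  have [rc|cr] := leP r c; last by apply: vi => //; exact: ltW.
  by rewrite distrC; apply: vi.
have : sup E <= `|v c| + sup E / 2.
  apply: ge_sup; first by exists `|v c|.
  move=> _ [r rab <-]; rewrite -[v r](subrKC (v c)).
  by apply: le_trans (ler_normD _ _) _; rewrite lerD2l inc.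
by have := vm _ t0ab; lra.
Qed.

(** [G] is chosen before [v], so one constant serves all pairs of solutions, and [c] may lie on
    either side of [t]. *)
Lemma gronwall l a b : L1loc l -> (forall t, 0 <= l t) -> a <= b ->
  exists G, 0 <= G /\ forall v, controlled l a b v ->
    forall t c, a <= t <= b -> a <= c <= b -> `|v t| <= G * `|v c|.
Proof.
move=> Ll l0 ab.
pose Q (a b : R) := exists G, 0 <= G /\ forall v, controlled l a b v ->
    forall t c, a <= t <= b -> a <= c <= b -> `|v t| <= G * `|v c|.
apply: (@small_steps _ Q l (1 / 2)) => //.
  move=> u w _ uw _ l2; exists 2; split => // v vi.
  exact: (controlled_local uw l2 vi).
move=> u v w _ uv vw _ [G [G0 GP]] [H [H0 HP]].
(* [G] or [H] serves when [t] and [c] lie on the same side of [v], and [G * H] when [v] separates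
   them. *)
exists (G + H + G * H); split; first by rewrite !addr_ge0// mulr_ge0.
move=> y yc t c /andP[ut tw] /andP[uc cw].
have y1 := GP y (controlledS (lexx _) vw yc).
have y2 := HP y (controlledS uv (lexx _) yc).
have n0 := normr_ge0 (y c).
have Gc := mulr_ge0 G0 n0; have Hc := mulr_ge0 H0 n0.
have GHc := mulr_ge0 G0 Hc.
rewrite !mulrDl -mulrA.
have [tv|/ltW tv] := leP t v; have [cv|/ltW cv] := leP c v.
- by have := y1 t c; rewrite ut tv uc cv => /(_ isT isT); lra.
- have := y1 t v; rewrite ut tv uv lexx => /(_ isT isT).
  have := y2 v c; rewrite lexx vw cv cw => /(_ isT isT) /(ler_wpM2l G0); lra.
- have := y2 t v; rewrite tv tw lexx vw => /(_ isT isT).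
  have := y1 v c; rewrite lexx uv uc cv => /(_ isT isT) /(ler_wpM2l H0).
  by rewrite mulrCA; lra.
- by have := y2 t c; rewrite tv tw cv cw => /(_ isT isT); lra.
Qed.

End sup_arguments.

(** * Primitives of integrable functions and one-sided differential inequalities *)

Section primitives.
Context {R : realType}.
Local Notation mu := (@lebesgue_measure R).
Implicit Types (a b c s t : R) (g h x y l : R -> R).

Lemma ae_neq (s : R) : {ae mu, forall t, t <> s}.
Proof.
exists [set s]; split => //; first exact: lebesgue_measure_set1.
by move=> t /= /contrapT.
Qed.

(** Absolute continuity of [x] with derivative [g]. Both ends of the increment vary, so restriction
    and concatenation need no change of base point. *)
Definition primitive_on a b g x := sintegrable a b g /\
  forall s t, a <= s -> s <= t -> t <= b -> x t - x s = sint s t g.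

Lemma primitive_on_base a b g x : sintegrable a b g ->
  (forall t, a <= t <= b -> x t = x a + sint a t g) -> primitive_on a b g x.
Proof.
move=> ig xE; split => // s t as_ st tb.
rewrite (xE t) ?(le_trans as_ st)// (xE s) ?as_ ?(le_trans st tb)//.
rewrite (sint_split (c := s) as_ st); last exact: sintegrableS ig.
by rewrite opprD addrACA subrr add0r addrAC subrr add0r.
Qed.

Lemma primitive_onS a b c d g x : a <= c -> d <= b -> primitive_on a b g x ->
  primitive_on c d g x.
Proof.
move=> ac db [ig xE]; split; first exact: sintegrableS ig.
by move=> s t cs st td; apply: xE => //; [exact: le_trans cs|exact: le_trans db].
Qed.

Lemma eq_primitive_on a b g h x y : (forall t, a <= t <= b -> g t = h t) ->
  (forall t, a <= t <= b -> x t = y t) ->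
  primitive_on a b g x -> primitive_on a b h y.
Proof.
move=> gh xy [ig xE]; split; first exact: eq_sintegrable ig.
move=> s t as_ st tb; rewrite -!xy ?as_ ?(le_trans st)// ?(le_trans as_)//.
rewrite xE//; apply: eq_sint => r /andP[sr rt].
by rewrite gh// (le_trans as_)//= (le_trans rt).
Qed.

Lemma primitive_onB a b g h x y : primitive_on a b g x -> primitive_on a b h y ->
  primitive_on a b (fun t => g t - h t) (fun t => x t - y t).
Proof.
move=> [ig xE] [ih yE]; split; first exact: sintegrableB.
move=> s t as_ st tb; rewrite sintB -?xE -?yE//.
- by ring.
- exact: sintegrableS ig.
- exact: sintegrableS ih.
Qed.

Lemma primitive_onZ a b k g x : primitive_on a b g x ->
  primitive_on a b (fun t => k * g t) (fun t => k * x t).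
Proof.
move=> [ig xE]; split; first exact: sintegrableZl.
move=> s t as_ st tb; rewrite sintZl; last exact: sintegrableS ig.
by rewrite -xE// mulrBr.
Qed.

Lemma primitive_on_sum a b (I : Type) (s : seq I) (g x : I -> R -> R) :
  (forall i, primitive_on a b (g i) (x i)) ->
  primitive_on a b (fun t => \sum_(i <- s) g i t) (fun t => \sum_(i <- s) x i t).
Proof.
move=> px; elim: s => [|i s [IH1 IH2]].
  split; first by apply: sintegrable_sum => i; have [] := px i.
  move=> s t as_ st tb; rewrite !big_nil subrr /sint /Rintegral.
  by under eq_integral do rewrite big_nil; rewrite integral0.
have [ii xi] := px i.
have E t : \sum_(j <- i :: s) g j t = g i t + \sum_(j <- s) g j t.
  by rewrite big_cons.
split; first by apply: sintegrable_sum => j; have [] := px j.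
move=> u t au ut tb.
rewrite (eq_sint (h := fun t => g i t + \sum_(j <- s) g j t)); last first.
  by move=> r _; exact: E.
rewrite sintD.
- by rewrite -xi// -IH2// !big_cons opprD addrACA.
- exact: sintegrableS ii.
- exact: sintegrableS IH1.
Qed.

Lemma primitive_on_continuous a b g x : a <= b -> primitive_on a b g x ->
  {within `[a, b], continuous x}.
Proof.
move=> ab [ig xE].
apply: (@subspace_eq_continuous _ _ _ (fun t => x a + sint a t g)).
  move=> t; rewrite inE/= in_itv/= => /andP[at_ tb].
  by rewrite -(xE a t) //= subrKC.
move=> t; apply: cvgD; first exact: cvg_cst.
exact: sint_continuous.
Qed.

Lemma primitive_on_bounded a b g x : primitive_on a b g x ->
  forall t, a <= t <= b -> `|x t| <= `|x a| + sint a b (fun t => `|g t|).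
Proof.
move=> [ig xE] t /andP[at_ tb]; rewrite -[x t](subrKC (x a)) xE//.
apply: le_trans (ler_normD _ _) _; rewrite lerD2l.
apply: le_trans (sint_norm _) _; first exact: sintegrableS ig.
by apply: sint_subset => //; exact: sintegrable_norm.
Qed.

Lemma sintegrable_cat a b c g : a <= b -> b <= c -> sintegrable a b g ->
  sintegrable b c g -> sintegrable a c g.
Proof.
move=> ab bc /integrableP[m1 i1] /integrableP[m2 i2].
have E : `[a, c]%classic = `[a, b[ `|` `[b, c].
  by rewrite (@itv_bndbnd_setU _ _ _ (BLeft b)) ?bnd_simp.
have m1' : measurable_fun `[a, b[ (EFin \o g).
  by apply: measurable_funS m1 => //; exact: subset_itv_co_cc.
have mg : measurable_fun `[a, c] (EFin \o g).
  by rewrite E; apply/measurable_funU.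
rewrite /sintegrable; apply/integrableP; split => //.
rewrite E ge0_integral_setU//=.
- apply: lte_add_pinfty => //; apply: le_lt_trans i1.
  apply: ge0_subset_integral => //=; last exact: subset_itv_co_cc.
  apply/measurable_EFinP; apply: measurableT_comp => //; exact/measurable_EFinP.
- rewrite -E; apply/measurable_EFinP; apply: measurableT_comp => //.
  exact/measurable_EFinP.
- apply/disj_setPS => t [/=]; rewrite !in_itv/= => /andP[_ tb] /andP[].
  by rewrite leNgt tb.
Qed.

Lemma primitive_on_cat a b c g h x y : a <= b -> b <= c ->
  g b = h b -> x b = y b -> primitive_on a b g x -> primitive_on b c h y ->
  primitive_on a c (fun t => if t <= b then g t else h t)
                   (fun t => if t <= b then x t else y t).
Proof.
move=> ab bc gh xy px py.
set G := (fun t => _); set X := (fun t => _).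
have [iG XG] : primitive_on a b G X.
  by apply: eq_primitive_on px => t /andP[_ tb]; rewrite /G /X tb.
have [iH XH] : primitive_on b c G X.
  by apply: eq_primitive_on py => t /andP[bt _]; rewrite /G /X;
    case: leP => // tb; have -> : t = b by apply/le_anti; rewrite tb bt.
have iac : sintegrable a c G by exact: sintegrable_cat iG iH.
split => // s t as_ st tc.
have [tb|/ltW bt] := leP t b; first exact: XG.
have [sb|/ltW bs] := leP s b; last exact: XH.
rewrite (sint_split (c := b))//; last exact: sintegrableS iac.
by rewrite -XG// -XH//; ring.
Qed.

(* The maximum of [v] satisfies [m <= m / 2 + int be], because a positive
   component is bounded by its increment since it was last nonpositive. *)
Lemma ode_one_sided n (v g : R -> 'I_n -> R) l be a b : a <= b ->
  sintegrable a b l -> sintegrable a b be ->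
  (forall t, 0 <= l t) -> (forall t, 0 <= be t) -> sint a b l <= 1 / 2 ->
  (forall i, primitive_on a b (g ^~ i) (v ^~ i)) -> (forall i, v a i <= 0) ->
  (forall i, {ae mu, forall r, a <= r <= b -> 0 < v r i ->
     forall m, 0 <= m -> (forall j, v r j <= m) -> g r i <= m * l r + be r}) ->
  forall t i, a <= t <= b -> v t i <= 2 * sint a b be.
Proof.
move=> ab il ibe l0 be0 l2 pv va gi.
apply: (one_sided_bound (k := sint a b l)) => //.
- exact: sint_ge0.
- by move=> i; exact: primitive_on_continuous (pv i).
move=> m i s t m0 as_ st tb vm pos.
have [ig vE] := pv i; rewrite (vE s t)//.
have ilm : sintegrable s t (fun r => m * l r + be r).
  apply: (@sintegrableS _ a b) => //.
  by apply: sintegrableD => //; exact: sintegrableZl.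
have ils : sintegrable s t l by exact: sintegrableS il.
have ibs : sintegrable s t be by exact: sintegrableS ibe.
apply: (@le_trans _ _ (sint s t (fun r => m * l r + be r))).
  apply: ae_le_sint => //; first exact: sintegrableS ig.
  (* Positivity of [v r i] is known only for [s < r]; the end [s] is discarded as a null set. *)
  apply: ae_imply (ae_and (gi i) (ae_neq s)) => r [gr /eqP rs] /andP[sr rt].
  have rab : a <= r <= b by rewrite (le_trans as_ sr) (le_trans rt tb).
  apply: gr => //; last by move=> j; exact: vm.
  by apply: pos; rewrite rt andbT lt_neqAle eq_sym rs.
rewrite sintD//; last exact: sintegrableZl.
by rewrite sintZl// lerD// ?ler_wpM2l// sint_subset.
Qed.

End primitives.

(** * Limits of real sequences with geometric increments *)

Section geometric_limit.
Context {R : realType}.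

(** [e n] is the sum of all increments from [n] on, so the intervals of radius [e n] around [u n]
    are nested; the supremum of their left ends lies in all of them. *)
Lemma geometric_limit (u : nat -> R) (C : R) : 0 <= C ->
  (forall n, `|u n.+1 - u n| <= C * 2^-1 ^+ n) ->
  exists l, forall n, `|l - u n| <= 2 * C * 2^-1 ^+ n.
Proof.
move=> C0 du; pose e n : R := 2 * C * 2^-1 ^+ n.
have eS n : e n.+1 = e n / 2 by rewrite /e exprS; ring.
have dS n : C * 2^-1 ^+ n = e n / 2 by rewrite /e; field.
have lo n k : u n - e n <= u (n + k)%N - e (n + k)%N.
  elim: k => [|k IH]; first by rewrite addn0.
  apply: le_trans IH _; rewrite addnS eS.
  by have := du (n + k)%N; rewrite dS ler_norml => /andP[]; lra.
have hi n k : u (n + k)%N + e (n + k)%N <= u n + e n.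
  elim: k => [|k IH]; first by rewrite addn0.
  apply: le_trans IH; rewrite addnS eS.
  by have := du (n + k)%N; rewrite dS ler_norml => /andP[]; lra.
have e0 n : 0 <= e n by rewrite /e !mulr_ge0// exprn_ge0.
have lohi n m : u m - e m <= u n + e n.
  have := lo m n; have := hi n m; rewrite addnC.
  by have := e0 (m + n)%N; lra.
pose E := [set u n - e n | n in [set: nat]].
exists (sup E) => n; rewrite ler_distl; apply/andP; split.
  apply: ub_le_sup; last by exists n.
  by exists (u n + e n) => _ [m _ <-].
by apply: ge_sup; [exists (u 0%N - e 0%N); exists 0%N|move=> _ [m _ <-]].
Qed.

Lemma geometric_cvg (u : nat -> R) (l C : R) :
  (forall n, `|l - u n| <= C * 2^-1 ^+ n) -> u @ \oo --> l.
Proof.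
move=> ul; apply/cvgrPdist_le => e e0.
have : (fun n => C * 2^-1 ^+ n : R) @ \oo --> (0 : R).
  by apply: cvg_geometric; rewrite ger0_norm; lra.
move=> /cvgrPdist_le/(_ e e0); apply: filterS => n; rewrite sub0r normrN => h.
by apply: le_trans (ul n) _; apply: le_trans h; exact: ler_norm.
Qed.

Lemma le_geometric0 (x C : R) : (forall n : nat, x <= C * 2^-1 ^+ n) -> x <= 0.
Proof.
move=> xC; rewrite leNgt; apply/negP => x0.
have : (fun n => C * 2^-1 ^+ n : R) @ \oo --> (0 : R).
  by apply: cvg_geometric; rewrite ger0_norm; lra.
move=> /cvgrPdist_lt/(_ x x0)[n _ /(_ n (leqnn _))].
rewrite sub0r normrN /= => h; have := xC n; have := ler_norm (C * 2^-1 ^+ n).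
by lra.
Qed.

End geometric_limit.

Lemma primitive_mx_bounded (R : realType) m p (a b : R)
    (g : R -> 'I_m -> 'I_p -> R) (Y : R -> 'M[R]_(m, p)) :
  (forall i j, primitive_on a b (fun r => g r i j) (fun r => Y r i j)) ->
  exists M, forall r, a <= r <= b -> `|Y r| <= M.
Proof.
move=> pY; pose c i j := sint a b (fun t => `|g t i j|).
have c0 i j : 0 <= c i j by apply: sint_ge0.
exists (`|Y a| + \sum_i \sum_j c i j) => r rab.
apply: mx_norm_le.
  by rewrite addr_ge0// sumr_ge0// => i _; rewrite sumr_ge0.
move=> i j; apply: le_trans (primitive_on_bounded (pY i j) rab) _.
apply: lerD; first exact: mx_entry_le.
rewrite (bigD1 i)//= (bigD1 j)//= -addrA lerDl addr_ge0//.
  by rewrite sumr_ge0.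
by rewrite sumr_ge0// => k _; rewrite sumr_ge0.
Qed.

(** * Existence and uniqueness for the linear equation *)

Section linear_ode.
Context {R : realType} {N : nat}.
Local Notation mu := (@lebesgue_measure R).
Variable A : R -> 'M[R]_N.
Hypothesis LA : L1loc_mx A.

(** Dominates every row sum, hence is a Lipschitz constant of [A t] for the maximum norm; as a
    finite sum of absolute values it is clearly locally integrable. *)
Definition mx_weight (t : R) : R := \sum_i \sum_k `|A t i k|.
Local Notation l := mx_weight.

Lemma mx_weight_ge0 t : 0 <= l t.
Proof. by apply: sumr_ge0 => i _; apply: sumr_ge0. Qed.

Lemma mx_weight_L1loc : L1loc l.
Proof. by do 2 (apply: L1loc_sum => ?); exact/L1loc_norm/LA. Qed.

Lemma row_weight_le t i : \sum_k `|A t i k| <= l t.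
Proof.
rewrite /mx_weight [leRHS](bigD1 i)//= lerDl.
by apply: sumr_ge0 => j _; apply: sumr_ge0.
Qed.

Lemma mulmx_weight_le p t (Y : 'M[R]_(N, p)) M i j : `|Y| <= M ->
  `|(A t *m Y) i j| <= M * l t.
Proof.
move=> YM; apply: le_trans (mulmx_entry_le _ _ _ _) _; rewrite mulrC.
by apply: ler_pM => //; [apply: sumr_ge0|exact: row_weight_le].
Qed.

Definition lin_sol p (a b : R) (Y : R -> 'M[R]_(N, p)) :=
  forall i j, primitive_on a b (fun r => (A r *m Y r) i j) (fun r => Y r i j).

Lemma lin_solS p a b c d (Y : R -> 'M[R]_(N, p)) : a <= c -> d <= b ->
  lin_sol a b Y -> lin_sol c d Y.
Proof. by move=> ac db sY i j; exact: primitive_onS (sY i j). Qed.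

Lemma lin_solB p a b (Y Z : R -> 'M[R]_(N, p)) : lin_sol a b Y ->
  lin_sol a b Z -> lin_sol a b (fun t => Y t - Z t).
Proof.
move=> sY sZ i j; apply: eq_primitive_on (primitive_onB (sY i j) (sZ i j)).
  by move=> t _; rewrite mulmxBr !mxE.
by move=> t _; rewrite !mxE.
Qed.

Lemma lin_solMr p q a b (Y : R -> 'M[R]_(N, p)) (C : 'M[R]_(p, q)) :
  lin_sol a b Y -> lin_sol a b (fun t => Y t *m C).
Proof.
move=> sY i j.
have := primitive_on_sum (index_enum 'I_p)
  (fun k => primitive_onZ (C k j) (sY i k)).
apply: eq_primitive_on => t _; rewrite ?mulmxA mxE;
  by apply: eq_bigr => k _; rewrite mulrC.
Qed.

Lemma lin_sol_bounded p a b (Y : R -> 'M[R]_(N, p)) : lin_sol a b Y ->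
  exists M, forall r, a <= r <= b -> `|Y r| <= M.
Proof. exact: primitive_mx_bounded. Qed.

Lemma lin_sol_controlled p a b (Y : R -> 'M[R]_(N, p)) : lin_sol a b Y ->
  controlled l a b Y.
Proof.
move=> sY; split; first exact: lin_sol_bounded.
move=> u w M au uw wb M0 YM t c ut tc cw.
have il x y : sintegrable x y l by exact: L1loc_sintegrable mx_weight_L1loc.
apply: mx_norm_le => [|i j].
  by rewrite mulr_ge0// sint_ge0//; exact: mx_weight_ge0.
have [ig YE] := sY i j.
rewrite !mxE YE ?(le_trans au)// ?(le_trans cw)//.
have igtc : sintegrable t c (fun r => (A r *m Y r) i j).
  by apply: sintegrableS ig; [exact: le_trans ut|exact: le_trans wb].
apply: le_trans (sint_norm igtc) _.
apply: (@le_trans _ _ (sint t c (fun r => M * l r))).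
  apply: le_sint; first exact: sintegrable_norm.
    exact: sintegrableZl.
  move=> r /andP[tr rc]; apply: mulmx_weight_le; apply: YM.
  by rewrite (le_trans ut)//= (le_trans rc).
rewrite sintZl// ler_wpM2l// sint_subset//; exact: mx_weight_ge0.
Qed.

Lemma lin_sol_unique p a b (Y Z : R -> 'M[R]_(N, p)) c t : a <= b ->
  lin_sol a b Y -> lin_sol a b Z -> a <= c <= b -> Y c = Z c ->
  a <= t <= b -> Y t = Z t.
Proof.
move=> ab sY sZ cab YZ tab.
have [G [G0 GP]] := @gronwall R N p l a b mx_weight_L1loc mx_weight_ge0 ab.
have := GP _ (lin_sol_controlled (lin_solB sY sZ)) t c tab cab.
by rewrite YZ subrr normr0 mulr0 normr_le0 subr_eq0 => /eqP.
Qed.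

Lemma lin_sol_cat p a b c (Y Z : R -> 'M[R]_(N, p)) : a <= b -> b <= c ->
  Y b = Z b -> lin_sol a b Y -> lin_sol b c Z ->
  lin_sol a c (fun t => if t <= b then Y t else Z t).
Proof.
move=> ab bc YZ sY sZ i j.
have := primitive_on_cat ab bc _ _ (sY i j) (sZ i j); rewrite YZ => /(_ erefl erefl).
by apply: eq_primitive_on => t _; case: ifP.
Qed.

Section picard.
Context {p : nat} (a b c : R) (Y0 : 'M[R]_(N, p)).
Hypotheses (ab : a <= b) (cab : a <= c <= b) (l2 : sint a b l <= 1 / 2).

(** Enough for [A r *m Y r] to be integrable, and preserved by [picard_step]; measurability survives
    pointwise limits. *)
Definition mx_regular (Y : R -> 'M[R]_(N, p)) :=
  (forall i j, measurable_fun `[a, b] (fun t => Y t i j)) /\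
  exists M, forall r, a <= r <= b -> `|Y r| <= M.

Lemma mx_regular_integrable Y i j : mx_regular Y ->
  sintegrable a b (fun r => (A r *m Y r) i j).
Proof.
move=> [mY [M YM]].
apply: (@eq_sintegrable _ _ _ (fun r => \sum_k A r i k * Y r k j)).
  by move=> t _; rewrite mxE.
apply: sintegrable_sum => k.
have ia := @L1loc_sintegrable _ _ a b (LA i k).
apply: (integrableMl _ ia (mY k j)) => //.
exists M; split; first exact: num_real.
move=> x Mx t /=; rewrite in_itv/= => tab.
by apply: le_trans (ltW Mx); apply: le_trans (YM t tab); exact: mx_entry_le.
Qed.

(** The difference of two integrals from [a] is the oriented integral from [c] to [t], which allows
    [t < c]. *)
Definition picard_step (Y : R -> 'M[R]_(N, p)) t : 'M[R]_(N, p) :=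
  \matrix_(i, j) (Y0 i j + (sint a t (fun r => (A r *m Y r) i j) -
                           sint a c (fun r => (A r *m Y r) i j))).

Lemma picard_stepP Y : mx_regular Y -> forall i j,
  primitive_on a b (fun r => (A r *m Y r) i j) (fun t => picard_step Y t i j).
Proof.
move=> rY i j; apply: primitive_on_base; first exact: mx_regular_integrable.
by move=> t tab; rewrite !mxE sint_refl; ring.
Qed.

Lemma picard_step_base Y : picard_step Y c = Y0.
Proof. by apply/matrixP => i j; rewrite mxE subrr addr0. Qed.

Lemma picard_step_regular Y : mx_regular Y -> mx_regular (picard_step Y).
Proof.
move=> rY; have pP := picard_stepP rY; split=> [i j|].
  apply: subspace_continuous_measurable_fun => //.
  exact: primitive_on_continuous (pP i j).
exact: primitive_mx_bounded pP.
Qed.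

(** Both images equal [Y0] at [c], so their distance is an increment from [c], and [l2] gives the
    factor 1/2. *)
Lemma picard_step_contract Y Z M : mx_regular Y -> mx_regular Z -> 0 <= M ->
  (forall r, a <= r <= b -> `|Y r - Z r| <= M) ->
  forall r, a <= r <= b -> `|picard_step Y r - picard_step Z r| <= M / 2.
Proof.
move=> rY rZ M0 YZ t tab.
apply: mx_norm_le => [|i j]; first exact: divr_ge0.
have pD := primitive_onB (picard_stepP rY i j) (picard_stepP rZ i j).
have [iD DE] := pD.
have inc s r : a <= s -> s <= r -> r <= b ->
    `|(picard_step Y r i j - picard_step Z r i j) -
      (picard_step Y s i j - picard_step Z s i j)| <= M / 2.
  move=> as_ sr rb; rewrite DE//.
  have iDs := sintegrableS as_ rb iD.
  apply: le_trans (sint_norm iDs) _.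
  have il x y : sintegrable x y l by exact: L1loc_sintegrable mx_weight_L1loc.
  apply: (@le_trans _ _ (sint s r (fun r => M * l r))).
    apply: le_sint; first exact: sintegrable_norm.
      exact: sintegrableZl.
    move=> q /andP[sq qr].
    have -> : (A q *m Y q) i j - (A q *m Z q) i j = (A q *m (Y q - Z q)) i j.
      by rewrite mulmxBr !mxE.
    by apply: mulmx_weight_le; apply: YZ; rewrite (le_trans as_)//= (le_trans qr).
  rewrite sintZl// ler_wpM2l//; apply: le_trans (_ : sint a b l <= _).
    by apply: sint_subset => //; exact: mx_weight_ge0.
  by apply: le_trans l2 _; rewrite mul1r.
have cE : picard_step Y c i j - picard_step Z c i j = 0.
  by rewrite !picard_step_base subrr.
have -> : (picard_step Y t - picard_step Z t) i j =
    picard_step Y t i j - picard_step Z t i j by rewrite !mxE.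
have /andP[at_ tb] := tab; have /andP[ac cb] := cab.
have [tc|/ltW ct] := leP t c.
  by have := inc t c at_ tc cb; rewrite cE sub0r normrN.
by have := inc c t ac ct tb; rewrite cE subr0.
Qed.

Lemma picard_local : exists Y, lin_sol a b Y /\ Y c = Y0.
Proof.
pose Yn n := iter n picard_step (fun=> Y0).
have rYn n : mx_regular (Yn n).
  elim: n => [|n IH]; last exact: picard_step_regular.
  by split=> //; exists `|Y0|.
have [M0 M0P] := (rYn 1%N).2.
pose C := `|M0| + `|Y0|.
have C0 : 0 <= C by rewrite addr_ge0.
have dY n r : a <= r <= b -> `|Yn n.+1 r - Yn n r| <= C * 2^-1 ^+ n.
  elim: n r => [|n IH] r rab.
    rewrite expr0 mulr1; apply: le_trans (ler_normB _ _) _; rewrite lerD2r.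
    by apply: le_trans (M0P r rab) _; exact: ler_norm.
  rewrite exprSr mulrA.
  apply: (picard_step_contract (rYn n.+1) (rYn n) _ IH) => //.
  by rewrite mulr_ge0// exprn_ge0.
have ex r i j : exists L, a <= r <= b ->
    forall n, `|L - Yn n r i j| <= 2 * C * 2^-1 ^+ n.
  have [rab|rab] := boolP (a <= r <= b); last by exists 0.
  have [L LP] : exists L, forall n, `|L - Yn n r i j| <= 2 * C * 2^-1 ^+ n.
    apply: geometric_limit => // n; apply: le_trans (dY n r rab).
    have -> : Yn n.+1 r i j - Yn n r i j = (Yn n.+1 r - Yn n r) i j.
      by rewrite !mxE.
    exact: mx_entry_le.
  by exists L.
have [L' LP'] := choice (fun x : R * 'I_N * 'I_p => ex x.1.1 x.1.2 x.2).
pose L r i j := L' (r, i, j).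
have LP r i j := LP' (r, i, j).
pose Y r : 'M[R]_(N, p) := \matrix_(i, j) L r i j.
have YYn n r : a <= r <= b -> `|Y r - Yn n r| <= 2 * C * 2^-1 ^+ n.
  move=> rab; apply: mx_norm_le => [|i j].
    by rewrite !mulr_ge0// exprn_ge0.
  by rewrite !mxE; exact: LP.
have rY : mx_regular Y.
  split=> [i j|].
    apply: (@measurable_fun_cvg _ _ _ _ (fun n r => Yn n r i j)).
      by move=> n; exact: (rYn n).1.
    move=> r /=; rewrite in_itv/= => rab; apply: (@geometric_cvg _ _ _ (2 * C)).
    by move=> n; rewrite mxE; exact: LP.
  exists (2 * C + `|Y0|) => r rab; rewrite -[Y r](subrK (Yn 0%N r)).
  apply: le_trans (ler_normD _ _) _; rewrite lerD2r.
  by apply: le_trans (YYn 0%N r rab) _; rewrite expr0 mulr1.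
(* Both sides are geometrically close to [Yn n.+1 r]: one by construction, the other by contraction.
   No limit under the integral is taken. *)
have fix_ r : a <= r <= b -> Y r = picard_step Y r.
  move=> rab; apply/eqP; rewrite -subr_eq0 -normr_le0.
  apply: (@le_geometric0 _ _ (2 * C)) => n.
  rewrite -(subrKA (Yn n.+1 r)); apply: le_trans (ler_normD _ _) _.
  have := YYn n.+1 r rab; rewrite exprSr mulrA => h1.
  have : `|picard_step (Yn n) r - picard_step Y r| <= (2 * C * 2^-1 ^+ n) / 2.
    apply: (picard_step_contract (rYn n) rY) => //.
      by rewrite !mulr_ge0// exprn_ge0.
    by move=> q qab; rewrite distrC; exact: YYn.
  move=> h2; apply: le_trans (lerD h1 h2) _.
  by lra.
exists Y; split; last by rewrite fix_// picard_step_base.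
move=> i j; apply: eq_primitive_on (picard_stepP rY i j) => // t tab.
by rewrite -fix_.
Qed.

End picard.

Lemma lin_sol_exists p a b c (Y0 : 'M[R]_(N, p)) : a <= b -> a <= c <= b ->
  exists Y, lin_sol a b Y /\ Y c = Y0.
Proof.
(* With [c] and [Y0] free, the half that contains [c] is solved first, and its value at the junction
   is the datum for the other half. *)
move=> ab; pose Q a b := forall c (Y0 : 'M[R]_(N, p)), a <= c <= b ->
  exists Y, lin_sol a b Y /\ Y c = Y0.
suff : Q a b by apply.
apply: (@small_steps _ Q l (1 / 2)) => //.
- exact: mx_weight_L1loc.
- exact: mx_weight_ge0.
- by move=> u v _ uv _ l2 {}c {}Y0 cuv; exact: picard_local.
move=> u v w _ uv vw _ Q1 Q2 {}c {}Y0 /andP[uc cw].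
have [cv|vc] := leP c v.
  have [Y [sY Yc]] := Q1 c Y0 ltac:(rewrite uc cv//).
  have [Z [sZ Zv]] := Q2 v (Y v) ltac:(rewrite lexx vw//).
  exists (fun t => if t <= v then Y t else Z t); rewrite cv; split => //.
  exact: lin_sol_cat.
have [Z [sZ Zc]] := Q2 c Y0 ltac:(rewrite cw (ltW vc)//).
have [Y [sY Yv]] := Q1 v (Z v) ltac:(rewrite lexx uv//).
exists (fun t => if t <= v then Y t else Z t); rewrite leNgt vc; split => //.
exact: lin_sol_cat.
Qed.

(** Solutions on the segments from [-n] to [n] agree on overlaps by uniqueness, so [Phi t] may read
    any one that reaches [t]. *)
Lemma fundamental_exists : exists Phi : R -> 'M[R]_N,
  (forall a b, lin_sol a b Phi) /\ Phi 0 = 1%:M.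
Proof.
have /choice[Y YP] n : exists Y : R -> 'M[R]_N,
    lin_sol (- n%:R) n%:R Y /\ Y 0 = 1%:M.
  by apply: lin_sol_exists; [|apply/andP; split];
    have := ler0n R n; lra.
pose Phi t := Y (Num.bound `|t|) t.
have PhiE (n : nat) t : - n%:R <= t <= n%:R -> Phi t = Y n t.
  move=> /andP[nt tn]; rewrite /Phi; set m := Num.bound `|t|.
  have tm : `|t| < m%:R by apply: archi_boundP.
  have [mn|/ltW nm] := leP m n.
    have mn' : (m%:R <= n%:R :> R) by rewrite ler_nat.
    apply: (@lin_sol_unique _ (- m%:R) m%:R _ _ 0) => //.
    - by have := ler0n R m; lra.
    - exact: (YP m).1.
    - by apply: lin_solS (YP n).1 => //; lra.
    - by have := ler0n R m => ?; apply/andP; split; lra.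
    - by rewrite (YP m).2 (YP n).2.
    - by move: tm; rewrite ltr_norml => /andP[? ?]; apply/andP; split; lra.
  have nm' : (n%:R <= m%:R :> R) by rewrite ler_nat.
  apply: (@lin_sol_unique _ (- n%:R) n%:R _ _ 0) => //.
  - by have := ler0n R n; lra.
  - by apply: lin_solS (YP m).1 => //; lra.
  - exact: (YP n).1.
  - by have := ler0n R n => ?; apply/andP; split; lra.
  - by rewrite (YP m).2 (YP n).2.
  - by apply/andP; split; lra.
exists Phi; split; last by rewrite (PhiE 0%N) ?oppr0 ?lexx// (YP 0%N).2.
move=> a b; pose n := maxn (Num.bound `|a|) (Num.bound `|b|).
have an : `|a| < n%:R.
  by apply: lt_le_trans (archi_boundP _) _ => //; rewrite ler_nat leq_maxl.
have bn : `|b| < n%:R.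
  by apply: lt_le_trans (archi_boundP _) _ => //; rewrite ler_nat leq_maxr.
move: an bn; rewrite !ltr_norml => /andP[? ?] /andP[? ?].
have sY : lin_sol a b (Y n) by apply: lin_solS (YP n).1; lra.
by move=> i j; apply: eq_primitive_on (sY i j) => t /andP[? ?];
  rewrite (PhiE n)//; apply/andP; split; lra.
Qed.

End linear_ode.

(** * The transition matrix: positivity and exponential bound *)

Section transition_matrix.
Context {R : realType} {N : nat}.
Local Notation mu := (@lebesgue_measure R).
Variable A : R -> 'M[R]_N.
Hypothesis LA : L1loc_mx A.
Local Notation l := (mx_weight A).

Lemma fundamental_matrixP (Phi : R -> 'M[R]_N) :
  (forall a b, lin_sol A a b Phi) -> Phi 0 = 1%:M -> fundamental_matrix A Phi.
Proof.
move=> sPhi Phi0 t i j; have [ig PhiE] := sPhi (Num.min 0 t) (Num.max 0 t) i j.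
split => //; rewrite /oint -Phi0; case: ifPn => [t0|].
  have := PhiE 0 t; rewrite /sint => <-//; first by rewrite subrKC.
  - by rewrite ge_min lexx.
  - by rewrite le_max lexx orbT.
rewrite -ltNge => /ltW t0; have := PhiE t 0; rewrite /sint => <-//.
- by rewrite opprB subrKC.
- by rewrite ge_min lexx orbT.
- by rewrite le_max lexx.
Qed.

Lemma lin_sol_ge0 p a b (Z : R -> 'M[R]_(N, p)) : a <= b ->
  (forall t i j, i != j -> 0 <= A t i j) -> lin_sol A a b Z ->
  (forall i j, 0 <= Z a i j) -> forall t i j, a <= t <= b -> 0 <= Z t i j.
Proof.
move=> ab offA sZ Za.
pose Q u v := (forall i j, 0 <= Z u i j) ->
  forall t i j, u <= t <= v -> 0 <= Z t i j.
suff : Q a b by apply.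
apply: (@small_steps _ Q l (1 / 2)) => //.
- exact: mx_weight_L1loc.
- exact: mx_weight_ge0.
- move=> u v au uv vb l2 Zu t i j tuv.
  have il : sintegrable u v l by exact/L1loc_sintegrable/mx_weight_L1loc.
  have i0 : sintegrable u v (fun=> 0) by exact/L1loc_sintegrable/L1loc0.
  have := @ode_one_sided _ N (fun t i => - Z t i j)
    (fun t i => - (A t *m Z t) i j) l (fun=> 0) u v uv il i0 (mx_weight_ge0 A)
    (fun=> lexx _) l2.
  have -> : sint u v (fun=> 0) = 0.
    by rewrite /sint /Rintegral integral0.
  rewrite mulr0 => H; rewrite -oppr_le0; apply: H => //.
  + move=> k; apply: eq_primitive_on
      (primitive_onZ (-1) (primitive_onS au vb (sZ k j))).
      by move=> r _; rewrite mulN1r.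
    by move=> r _; rewrite mulN1r.
  + by move=> k; rewrite oppr_le0.
  (* Off the diagonal the coefficient is nonnegative and [- Z r q j <= m] suffices; on the diagonal
     its sign is unknown, but [- Z r k j] is positive and so bounded by [m] in absolute value. *)
  move=> k; apply: aeW => r ruv Zk m m0 Zm; rewrite addr0 mxE -sumrN.
  apply: (@le_trans _ _ (m * \sum_q `|A r k q|)); last first.
    by rewrite ler_wpM2l// row_weight_le.
  rewrite mulr_sumr; apply: ler_sum => q _; rewrite -mulrN mulrC.
  have [kq|kq] := eqVneq q k.
    rewrite kq; apply: (@le_trans _ _ (`|- Z r k j| * `|A r k k|)).
      by rewrite -normrM ler_norm.
    by rewrite ler_wpM2r// gtr0_norm.
  by rewrite ger0_norm ?offA 1?eq_sym// ler_wpM2r// offA// eq_sym.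
move=> u v w _ uv vw _ Q1 Q2 Zu t i j /andP[ut tw].
have [tv|/ltW vt] := leP t v; first by apply: Q1; rewrite ?ut.
by apply: Q2; rewrite ?vt// => i' j'; apply: Q1; rewrite ?uv ?lexx.
Qed.

Variable Phi : R -> 'M[R]_N.
Hypotheses (sPhi : forall a b, lin_sol A a b Phi) (Phi0 : Phi 0 = 1%:M).

(** Let [Psi] solve the equation with value 1 at [s]. Uniqueness identifies [Psi t *m Phi s] with
    [Phi t], and at [t = 0] this exhibits a left inverse of [Phi s]. *)
Lemma fundamental_unit s : Phi s \in unitmx.
Proof.
have ss : - `|s| <= s <= `|s| by rewrite -ler_norml.
have s0 : - `|s| <= 0 <= `|s| by rewrite oppr_le0 normr_ge0.
have ab : - `|s| <= `|s| by have := normr_ge0 s; lra.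
have [Psi [sPsi Psis]] := lin_sol_exists LA (1%:M : 'M[R]_N) ab ss.
have := lin_sol_unique LA ab (lin_solMr (Phi s) sPsi) (sPhi _ _) ss _ s0.
by rewrite Psis mul1mx Phi0 => /(_ erefl) /mulmx1_unit[].
Qed.

Definition transition t s : 'M[R]_N := Phi t *m invmx (Phi s).
Local Notation U := transition.

Lemma transition_refl s : U s s = 1%:M.
Proof. by rewrite /U mulmxV// fundamental_unit. Qed.

Lemma transition_comp t r s : U t r *m U r s = U t s.
Proof. by rewrite /U mulmxA mulmxKV// fundamental_unit. Qed.

Lemma transition_lin_sol a b s : lin_sol A a b (fun t => U t s).
Proof. exact: lin_solMr. Qed.

Lemma transition_ge0 s t i j : (forall t i j, i != j -> 0 <= A t i j) ->
  s <= t -> 0 <= U t s i j.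
Proof.
move=> offA st; apply: (lin_sol_ge0 st offA (@transition_lin_sol s t s)).
  by move=> {}i {}j; rewrite transition_refl mxE; case: (_ == _).
by rewrite st lexx.
Qed.

(** (A3) stops at time 0. On [[0, T]] Gronwall gives a bound [H], and the factor [e] pays for the
    decay missing there. *)
Lemma transition_bound tau : A3 A -> exists al K, [/\ 0 < al, 0 <= K &
  forall s t, s <= t -> t <= tau -> `|U t s| <= K * expR (- al * (t - s))].
Proof.
move=> [al [K [al0 [K1 UK]]]]; exists al.
have {}UK := UK _ (fundamental_matrixP sPhi Phi0).
have K0 : 0 <= K by lra.
pose T := Num.max tau 0.
have T0 : 0 <= T by rewrite le_max lexx orbT.
have tauT : tau <= T by rewrite le_max lexx.
have [G [G0 GP]] := @gronwall R N N l 0 T (mx_weight_L1loc LA)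
  (mx_weight_ge0 A) T0.
pose H := G * `|1%:M : 'M[R]_N|.
have H0 : 0 <= H by rewrite mulr_ge0.
have UG s t : 0 <= s -> s <= t -> t <= T -> `|U t s| <= H.
  move=> s0 st tT; rewrite /H -(transition_refl s).
  apply: (GP (fun t => U t s)); first exact/(lin_sol_controlled LA)/transition_lin_sol.
    by rewrite (le_trans s0).
  by rewrite s0 (le_trans st).
pose e := expR (al * T).
have e0 : 0 <= e by exact: expR_ge0.
have x0 s t : 0 <= expR (- al * (t - s)) by exact: expR_ge0.
(* One term for each case: [t <= 0], then [0 <= s], then [s <= 0 <= t], where [U t s] factors
   through time 0. *)
exists (K + H * e + N%:R * H * K * e); split => //.
  by rewrite !addr_ge0// !mulr_ge0.
move=> s t st ttau; set x := expR _.
have h1 : 0 <= K * x by rewrite mulr_ge0// x0.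
have h2 : 0 <= H * e * x by rewrite !mulr_ge0// x0.
have h3 : 0 <= N%:R * H * K * e * x by rewrite !mulr_ge0// x0.
rewrite !mulrDl.
have [t0|/ltW t0] := leP t 0.
  by have : `|U t s| <= K * x := UK s t st t0; lra.
have tT : t <= T by exact: le_trans tauT.
have [s0|/ltW s0] := leP 0 s.
  have ex1 : 1 <= e * x.
    rewrite /e /x -expRD -[leLHS]expR0 ler_expR.
    have : al * t <= al * T by rewrite ler_pM2l.
    have : 0 <= al * s by rewrite mulr_ge0// ltW.
    by lra.
  have := UG s t s0 st tT; have := ler_wpM2l H0 ex1; rewrite mulr1 mulrA; lra.
rewrite -(transition_comp t 0 s).
have h4 := mulmx_norm_le (U t 0) (U 0 s).
have h5 := UG 0 t (lexx _) t0 tT.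
have h6 : `|U 0 s| <= K * (e * x).
  apply: le_trans (UK s 0 s0 (lexx _)) _; rewrite ler_wpM2l//.
  rewrite /e /x -expRD ler_expR.
  have : al * t <= al * T by rewrite ler_pM2l.
  by lra.
have : `|U t 0 *m U 0 s| <= N%:R * H * K * e * x.
  have h7 := ler_pM (normr_ge0 _) (normr_ge0 _) h5 h6.
  have := ler_wpM2l (ler0n R N) h7.
  have -> : N%:R * (H * (K * (e * x))) = N%:R * H * K * e * x by ring.
  by apply: le_trans; rewrite mulrA.
by lra.
Qed.

End transition_matrix.

(** * Slices of null sets in the product space *)

Section box_slices.
Context {R : realType}.
Local Notation mu := (@lebesgue_measure R).
Local Notation comp := Defs.comp.

Lemma measurable_weighted_indic (C a b : R) (D : set R) : measurable D ->
  measurable_fun D (fun x => (C * \1_`[a, b] x)%:E).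
Proof.
move=> mD; apply/measurable_EFinP; apply: measurable_funM => //.
Qed.

Lemma integral_weighted_indic (C a b : R) (D : set R) : measurable D ->
  0 <= C -> a <= b ->
  (\int[mu]_(x in D) (C * \1_`[a, b] x)%:E <= (C * (b - a))%:E)%E.
Proof.
move=> mD C0 ab.
rewrite (@integralZl_indic _ _ _ mu D mD (fun=> `[a, b]%classic))//; last first.
  by rewrite ltNge C0.
rewrite EFinM lee_wpmul2l ?lee_fin// integral_indic//.
apply: (@le_trans _ _ (mu `[a, b])).
  by apply: le_measure; rewrite ?inE//; apply: measurableI.
rewrite lebesgue_measure_itv/= lte_fin; case: ltP => // _.
by rewrite lee_fin subr_ge0.
Qed.

Definition cons_coord n (y0 : R) (y : 'I_n -> R) (i : 'I_n.+1) : R :=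
  if unlift ord0 i is Some j then y j else y0.

Lemma cons_coord0 n y0 (y : 'I_n -> R) : cons_coord y0 y ord0 = y0.
Proof. by rewrite /cons_coord unlift_none. Qed.

Lemma cons_coordS n y0 (y : 'I_n -> R) j : cons_coord y0 y (lift ord0 j) = y j.
Proof. by rewrite /cons_coord liftK. Qed.

(* The weights [w] make the induction on the dimension go through: slicing at
   the first coordinate multiplies them by an indicator, and integrating the
   slices restores the factor [b k ord0 - a k ord0]. *)
Lemma box_cover_volume n (c d : 'I_n -> R) (a b : nat -> 'I_n -> R)
    (w : nat -> R) :
  (forall k, 0 <= w k) -> (forall k i, a k i <= b k i) ->
  (forall i, c i <= d i) ->
  (forall y : 'I_n -> R, (forall i, c i <= y i <= d i) ->
    (1 <= \sum_(k <oo) (w k * \prod_i \1_`[a k i, b k i] (y i))%:E)%E) ->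
  ((\prod_i (d i - c i))%:E <=
    \sum_(k <oo) (w k * \prod_i (b k i - a k i))%:E)%E.
Proof.
elim: n c d a b w => [|n IH] c d a b w w0 ab cd cov.
  have := cov (fun=> 0); rewrite big_ord0.
  under eq_eseriesr do rewrite big_ord0.
  under [X in _ -> (_ <= X)%E]eq_eseriesr do rewrite big_ord0.
  by apply => -[].
pose a' k i := a k (lift ord0 i); pose b' k i := b k (lift ord0 i).
pose P k := \prod_(i < n) (b' k i - a' k i).
have P0 k : 0 <= P k by apply: prodr_ge0 => i _; rewrite subr_ge0; exact: ab.
pose V := \prod_(i < n) (d (lift ord0 i) - c (lift ord0 i)).
have slice y0 : c ord0 <= y0 <= d ord0 -> (V%:E <=
    \sum_(k <oo) ((w k * P k) * \1_`[a k ord0, b k ord0] y0)%:E)%E.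
  move=> y0cd.
  under eq_eseriesr do rewrite mulrAC.
  apply: IH => //.
  - by move=> k; rewrite mulr_ge0.
  - by move=> k i; exact: ab.
  move=> y ycd; have := cov (cons_coord y0 y).
  under eq_eseriesr do rewrite big_ord_recl cons_coord0 mulrA.
  under eq_eseriesr do under eq_bigr do rewrite cons_coordS.
  apply => i; have [j ->|->] := unliftP ord0 i.
    by rewrite cons_coordS.
  by rewrite cons_coord0.
rewrite big_ord_recl -/V.
under eq_eseriesr do rewrite big_ord_recl mulrCA -/(P _).
pose D : set R := `[c ord0, d ord0]%classic.
have mD : measurable D by exact: measurable_itv.
apply: (@le_trans _ _ (\int[mu]_(x in D) V%:E)%E).
  have muD : mu D = if c ord0 < d ord0 then (d ord0 - c ord0)%:E else 0%E.
    by rewrite /D lebesgue_measure_itv/= lte_fin; case: ifP.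
  have -> : (\int[mu]_(x in D) V%:E = V%:E * mu D)%E by exact: integral_cst.
  rewrite muD; case: ltP => [_|dc].
    by rewrite -EFinM mulrC.
  by rewrite mule0 lee_fin mulr_le0_ge0 ?subr_le0// prodr_ge0// => i _;
    rewrite subr_ge0.
apply: (@le_trans _ _ (\int[mu]_(x in D)
    \sum_(k <oo) ((w k * P k) * \1_`[a k ord0, b k ord0] x)%:E)%E).
  apply: ge0_le_integral => //.
  - by move=> x _; rewrite lee_fin prodr_ge0// => i _; rewrite subr_ge0.
  - apply: ge0_emeasurable_sum => [k x _ _|k _].
      by rewrite lee_fin !mulr_ge0.
    exact: measurable_weighted_indic.
rewrite integral_nneseries//.
- apply: lee_nneseries => [k _ _|k _].
    by apply: integral_ge0 => x _; rewrite lee_fin !mulr_ge0.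
  rewrite [(_ - _) * _]mulrC; apply: integral_weighted_indic => //.
  by rewrite mulr_ge0.
- by move=> k; exact: measurable_weighted_indic.
- by move=> k x _; rewrite lee_fin !mulr_ge0.
Qed.

Lemma le_half_powers (x : \bar R) : (forall n : nat, x <= (2^-1 ^+ n : R)%:E)%E ->
  (x <= 0)%E.
Proof.
move=> xn; case: x xn => [x|/(_ 0%N)|//] xn; last by rewrite leye_eq.
rewrite lee_fin; apply: (@le_geometric0 _ _ 1) => n.
by have := xn n; rewrite lee_fin mul1r.
Qed.

(** Let [g t] be the total spatial volume of the covering boxes that meet time [t]. Its integral is
    at most [V * 2^-1 ^+ n], whereas [g t >= V] whenever the slice contains the whole box from [c]
    to [d]. Markov's inequality encloses these times in a measurable set of measure at most
    [2^-1 ^+ n]. *)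
Lemma null_prod_slice N (E : set (R * 'cV[R]_N)) (c d : 'cV[R]_N) :
  null_prod E -> (forall i, comp c i < comp d i) ->
  {ae mu, forall t, exists y, (forall i, comp c i <= comp y i <= comp d i) /\
                              ~ E (t, y)}.
Proof.
move=> nE cd; pose V := \prod_i (comp d i - comp c i).
have V0 : 0 < V by apply: prodr_gt0 => i _; rewrite subr_gt0.
have /choice[F FP] (n : nat) : exists F : set R, [/\ measurable F,
    (mu F <= (2^-1 ^+ n : R)%:E)%E & forall t,
    (forall y, (forall i, comp c i <= comp y i <= comp d i) -> E (t, y)) -> F t].
  have e0 : 0 < V * 2^-1 ^+ n by rewrite mulr_gt0// exprn_gt0.
  have [a0 [b0 [a [b [ab [Ecov vol]]]]]] := nE _ e0.
  pose P k := \prod_i (comp (b k) i - comp (a k) i).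
  have P0 k : 0 <= P k.
    by apply: prodr_ge0 => i _; rewrite subr_ge0; have [_] := ab k; exact.
  pose g t := (\sum_(k <oo) (P k * \1_`[a0 k, b0 k] t)%:E)%E.
  have mg : measurable_fun setT g.
    apply: ge0_emeasurable_sum => [k x _ _|k _].
      by rewrite lee_fin mulr_ge0.
    exact: measurable_weighted_indic.
  have g0 t : (0 <= g t)%E.
    by apply: nneseries_ge0 => k _ _; rewrite lee_fin mulr_ge0.
  have ig : (\int[mu]_t g t <= (V * 2^-1 ^+ n)%:E)%E.
    rewrite integral_nneseries//; last 2 first.
    - by move=> k; exact: measurable_weighted_indic.
    - by move=> k x _; rewrite lee_fin mulr_ge0.
    apply: (@le_trans _ _ (\sum_(k <oo) (P k * (b0 k - a0 k))%:E)%E).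
      apply: lee_nneseries => [k _ _|k _].
        by apply: integral_ge0 => x _; rewrite lee_fin mulr_ge0.
      by apply: integral_weighted_indic => //; have [] := ab k.
    apply: lime_le.
      apply: is_cvg_nneseries => k _ _.
      by rewrite lee_fin mulr_ge0// subr_ge0; have [] := ab k.
    apply: nearW => m; rewrite sumEFin lee_fin big_mkord.
    by apply: le_trans (vol m); apply: ler_sum => k _; rewrite mulrC.
  exists [set t | (V%:E <= `|g t|)%E]; split.
  - rewrite -[X in measurable X]setTI.
    by apply: emeasurable_fun_c_infty => //; exact: measurableT_comp.
  - have := @le_integral_abse _ _ _ mu setT measurableT g V mg V0.
    rewrite setTI => /le_trans h.
    have : (V%:E * mu [set t | (V%:E <= `|g t|)%E] <= (V * 2^-1 ^+ n)%:E)%E.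
      by apply: h; under eq_integral do rewrite gee0_abs//.
    by rewrite EFinM lee_pmul2l// lte_fin.
  move=> t cube /=; rewrite gee0_abs//.
  have -> : g t = (\sum_(k <oo) (\1_`[a0 k, b0 k] t *
      \prod_i (comp (b k) i - comp (a k) i))%:E)%E.
    by apply: eq_eseriesr => k _; rewrite mulrC.
  apply: (@box_cover_volume N (comp c) (comp d) (fun k => comp (a k))
    (fun k => comp (b k))) => //.
  - by move=> k i; have [_] := ab k; exact.
  - by move=> i; exact: ltW.
  move=> y ycd.
  have : E (t, \col_i y i) by apply: cube => i; have := ycd i; rewrite /Defs.comp mxE.
  move=> /Ecov [k _ [/= tk yk]].
  have tI : \1_`[a0 k, b0 k] t = 1 :> R.
    by rewrite indicE mem_set//= in_itv.
  have yI : \prod_i \1_`[comp (a k) i, comp (b k) i] (y i) = 1 :> R.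
    apply: big1 => i _; rewrite indicE mem_set//= in_itv/=.
    by have := yk i; rewrite /Defs.comp mxE.
  pose u j := (\1_`[a0 j, b0 j] t * \prod_i \1_`[comp (a j) i, comp (b j) i] (y i))%:E : \bar R.
  have u0 j : (0 <= u j)%E by rewrite lee_fin mulr_ge0// prodr_ge0.
  have := @nneseries_lim_ge R u xpredT 0 k.+1 (fun j _ _ => u0 j).
  apply: le_trans; rewrite big_nat_recr//= {2}/u tI yI mulr1.
  by rewrite leeDr// sume_ge0.
exists (\bigcap_n F n); split.
- by apply: bigcap_measurable => // n _; have [] := FP n.
- apply/eqP; rewrite eq_le measure_ge0 andbT; apply: le_half_powers => n.
  have [mF muF _] := FP n; apply: le_trans muF; apply: le_measure; rewrite ?inE//.
    by apply: bigcap_measurable => // k _; have [] := FP k.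
  exact: bigcap_inf.
- move=> t /= nex n _; have [_ _] := FP n; apply => y ycd.
  by apply: contrapT => nEy; apply: nex; exists y.
Qed.

End box_slices.

(** * Exceptional sets of times independent of the state *)

Section caratheodory_field.
Context {R : realType} {N : nat}.
Local Notation mu := (@lebesgue_measure R).
Local Notation comp := Defs.comp.
Local Notation vec := 'cV[R]_N.
Implicit Types (x y : vec) (f : R -> vec -> vec).

Lemma comp_le_norm x i : `|comp x i| <= `|x|.
Proof. exact: mx_entry_le. Qed.

Lemma vec_norm_le x c : 0 <= c -> (forall i, `|comp x i| <= c) -> `|x| <= c.
Proof. by move=> c0 xc; apply: mx_norm_le => // i j; rewrite [j]ord1; exact: xc. Qed.

Lemma norm_trmx m n (M : 'M[R]_(m, n)) : `|M^T| = `|M|.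
Proof.
by apply/le_anti/andP; split; apply: mx_norm_le => // i j;
  have := mx_entry_le; [move=> /(_ _ _ _ M j i)|move=> /(_ _ _ _ M^T j i)];
  rewrite mxE.
Qed.

(** Transposition is an isometry onto row vectors, where [bounded_closed_compact] applies. *)
Lemma cV_bounded_closed_compact (D : set vec) : Defs.bounded D -> closed D ->
  compact D.
Proof.
move=> [M DM] cD.
have ct : continuous (fun v : 'rV[R]_N => v^T : vec).
  move=> v B /nbhs_ballP[e e0 Be]; apply/nbhs_ballP; exists e => // w vw.
  by apply: Be; move: vw; rewrite -!ball_normE/= -linearB norm_trmx.
have -> : D = trmx @` [set v : 'rV[R]_N | D v^T].
  apply/seteqP; split=> [x Dx|_ [v Dv <-]//].
  by exists x^T; rewrite /= trmxK.
apply: continuous_compact; first exact: continuous_subspaceT.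
apply: bounded_closed_compact.
  exists M; split; first exact: num_real.
  move=> c Mc v /= /DM; rewrite norm_trmx => h.
  exact: le_trans h (ltW Mc).
exact: (closed_comp (fun v _ => ct v) cD).
Qed.

Lemma cball_compact (r : R) : compact [set x : vec | `|x| <= r].
Proof.
apply: cV_bounded_closed_compact; first by exists r.
apply: (@closed_comp _ _ (fun x : vec => `|x|) [set c | c <= r]).
  by move=> x _; exact: norm_continuous.
exact: closed_le.
Qed.

Lemma LC_lipschitz f r : LC f -> exists l : R -> R,
  [/\ L1loc l, forall t, 0 <= l t & {ae mu, forall t, forall x y,
    `|x| <= r -> `|y| <= r -> `|f t x - f t y| <= l t * `|x - y|}].
Proof.
move=> [_ /(_ _ (@cball_compact r))[m [l [_ [Ll ml]]]]].
exists (fun t => `|l t|); split => //; first exact: L1loc_norm.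
apply: ae_imply ml => t ml x y xr yr; have [_] := ml x y xr yr.
by move/le_trans; apply; rewrite ler_wpM2r// ler_norm.
Qed.

Lemma ae_countable (T : countType) (P : T -> R -> Prop) :
  (forall q, {ae mu, forall t, P q t}) -> {ae mu, forall t, forall q, P q t}.
Proof.
move=> aP.
have h (n : nat) : {ae mu, forall t, if unpickle n is Some q then P q t else True}.
  by case: (unpickle n) => [q|]; [exact: aP|exact: aeW].
apply: ae_imply (ae_foralln h) => t Pt q.
by have := Pt (pickle q); rewrite pickleK.
Qed.

Lemma LC_lipschitz_ae f : LC f -> {ae mu, forall t, forall n : nat,
  exists l, 0 <= l /\ forall x y, `|x| <= n%:R -> `|y| <= n%:R ->
    `|f t x - f t y| <= l * `|x - y|}.
Proof.
move=> Lf; apply: ae_foralln => n.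
have [l [_ l0 lP]] := LC_lipschitz n%:R Lf.
by apply: ae_imply lP => t lt; exists (l t).
Qed.

Definition ratv (q : 'cV[rat]_N) : vec := map_mx ratr q.

(** A rational approximation is useful only on the same face of the cone: coordinate [i] is kept
    exactly 0 and the others are approached from above. *)
Lemma A1_ae f : LC f -> A1 f -> {ae mu, forall t, forall x i, cone x ->
  comp x i = 0 -> 0 <= comp (f t x) i}.
Proof.
move=> Lf a1.
have rat_ae : {ae mu, forall t, forall qi : 'cV[rat]_N * 'I_N,
    cone (ratv qi.1) -> comp (ratv qi.1) qi.2 = 0 ->
    0 <= comp (f t (ratv qi.1)) qi.2}.
  apply: ae_countable => -[q i] /=.
  have [cq|ncq] := pselect (cone (ratv q)); last by apply: aeW => t /ncq.
  have [qi|nqi] := pselect (comp (ratv q) i = 0); last by apply: aeW => t _ /nqi.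
  by apply: ae_imply (a1 _ i cq qi) => t h _ _.
apply: ae_imply (ae_and rat_ae (LC_lipschitz_ae Lf)) => t [ratt lipt] x i cx xi.
pose n := (Num.bound `|x|).+1.
have xn : `|x| + 1 <= n%:R.
  by rewrite /n -natr1 lerD2r ltW// archi_boundP.
have [l [l0 lP]] := lipt n.
rewrite leNgt; apply/negP => fneg.
(* [1] keeps the approximation in the ball of radius [n]; the other bound makes the Lipschitz error
   at most half of the supposed defect. *)
pose del := Num.min 1 (- comp (f t x) i / (l + 1) / 2).
have l10 : 0 < l + 1 by lra.
have del0 : 0 < del by rewrite lt_min ltr01 !divr_gt0// oppr_gt0.
have /choice[q qP] (j : 'I_N) : exists q : rat, 0 <= (ratr q : R) /\
    `|comp x j - ratr q| <= del /\ (j = i -> q = 0).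
  have [->|ji] := eqVneq j i.
    by exists 0; rewrite xi raddf0 subrr normr0; split => //; split => //; exact: ltW.
  have xd : comp x j < comp x j + del by lra.
  have [q] := rat_in_itvoo xd; rewrite in_itv/= => /andP[q1 q2]; exists q.
  split; first by rewrite (le_trans (cx j))// ltW.
  split; last by move=> jie; rewrite jie eqxx in ji.
  by rewrite ler_distlC; apply/andP; split; lra.
pose v : 'cV[rat]_N := \col_j q j.
have vE j : comp (ratv v) j = ratr (q j) by rewrite /Defs.comp !mxE.
have cv : cone (ratv v) by move=> j; rewrite vE; have [] := qP j.
have vi : comp (ratv v) i = 0.
  by rewrite vE; have [_ [_ ->]] := qP i; rewrite ?raddf0.
have dist : `|x - ratv v| <= del.
  apply: vec_norm_le => [|j]; first exact: ltW.
  have -> : comp (x - ratv v) j = comp x j - comp (ratv v) j.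
    by rewrite /Defs.comp !mxE.
  by rewrite vE; have [_ []] := qP j.
have del1 : del <= 1 by rewrite ge_min lexx.
have vn : `|ratv v| <= n%:R.
  rewrite -[ratv v](subKr x); apply: le_trans (ler_normB _ _) _.
  by apply: le_trans xn; rewrite lerD2l (le_trans dist).
have f1 := ratt (v, i) cv vi.
have f2 := lP x (ratv v) ltac:(by apply: le_trans xn; rewrite lerDl) vn.
have f3 := comp_le_norm (f t x - f t (ratv v)) i.
have f4 : comp (f t x - f t (ratv v)) i = comp (f t x) i - comp (f t (ratv v)) i.
  by rewrite /Defs.comp !mxE.
have f5 : l * `|x - ratv v| <= (l + 1) * del.
  by apply: ler_pM => //; lra.
have f6 : (l + 1) * del <= - comp (f t x) i / 2.
  rewrite mulrC -ler_pdivlMr// ge_min; apply/orP; right.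
  by rewrite le_eqVlt; apply/orP; left; apply/eqP; field; rewrite gt_eqF.
move: f3; rewrite f4 ler_norml => /andP[f3 _].
move: f1 => /= f1.
have := le_trans f2 (le_trans f5 f6).
by move: f3; set z := `|f t x - f t (ratv v)|; lra.
Qed.

(** For almost every [t], each rational cube contains a state outside the slice of [E]. A small cube
    placed just above [x] yields such a state inside the cone and close to [x]. *)
Lemma A2_ae f A b : LC f -> A2 f A b -> {ae mu, forall t, forall x, cone x ->
  vle (f t x) (A t *m x + b t)}.
Proof.
move=> Lf [LA [_ [_ [_ [E [nE fE]]]]]].
have cube_ae : {ae mu, forall t, forall qn : 'cV[rat]_N * nat,
    exists y, (forall i, comp (ratv qn.1) i <= comp y i <=
                comp (ratv qn.1) i + qn.2.+1%:R^-1) /\ ~ E (t, y)}.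
  apply: ae_countable => -[q n] /=.
  pose d : vec := \col_i (comp (ratv q) i + n.+1%:R^-1).
  have dE i : comp d i = comp (ratv q) i + n.+1%:R^-1 by rewrite [LHS]mxE.
  have qd i : comp (ratv q) i < comp d i by rewrite dE ltrDl invr_gt0.
  apply: ae_imply (null_prod_slice nE qd) => t [y [yq nEy]].
  by exists y; split => // i; rewrite -dE.
apply: ae_imply (ae_and cube_ae (LC_lipschitz_ae Lf)) => t [cubet lipt] x cx i.
pose n := (Num.bound `|x|).+1.
have xn : `|x| + 1 <= n%:R.
  by rewrite /n -natr1 lerD2r ltW// archi_boundP.
have [l [l0 lP]] := lipt n.
rewrite leNgt; apply/negP => fbig.
pose w := mx_weight A t.
have w0 : 0 <= w by exact: mx_weight_ge0.
pose gap := comp (f t x) i - comp (A t *m x + b t) i.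
have gap0 : 0 < gap by rewrite subr_gt0.
have lw : 0 < l + w + 1 by lra.
(* Moving from [y] to [x] costs [l] on the side of [f] and [w] on the side of [A t]. *)
pose del := Num.min 1 (gap / (l + w + 1) / 2).
have del0 : 0 < del by rewrite lt_min ltr01 !divr_gt0.
have [k kdel] : exists k : nat, k.+1%:R^-1 < del / 2 :> R.
  exists (Num.bound (del / 2)^-1).
  rewrite invf_plt ?posrE//; last by rewrite divr_gt0.
  apply: lt_le_trans (archi_boundP _) _; last by rewrite ler_nat.
  by rewrite invr_ge0 divr_ge0// ltW.
have /choice[q qP] (j : 'I_N) : exists q : rat,
    comp x j <= ratr q <= comp x j + del / 2.
  have xd : comp x j < comp x j + del / 2 by lra.
  have [q] := rat_in_itvoo xd; rewrite in_itv/= => /andP[q1 q2]; exists q.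
  by rewrite !ltW.
have [y [yq nEy]] := cubet (\col_j q j, k).
move: kdel yq; rewrite /=; set e := _^-1 => kdel yq.
have yx j : comp x j <= comp y j <= comp x j + del.
  have vE : comp (ratv (\col_j q j)) j = ratr (q j) by rewrite /Defs.comp !mxE.
  have := yq j; rewrite /= vE => /andP[? ?].
  by have /andP[? ?] := qP j; apply/andP; split; lra.
have cy : cone y by move=> j; have /andP[h _] := yx j; exact: le_trans (cx j) h.
have dist : `|x - y| <= del.
  apply: vec_norm_le => [|j]; first exact: ltW.
  have -> : comp (x - y) j = comp x j - comp y j by rewrite /Defs.comp !mxE.
  by have /andP[? ?] := yx j; rewrite ler_distlC; apply/andP; split; lra.
have del1 : del <= 1 by rewrite ge_min lexx.
have yn : `|y| <= n%:R.
  rewrite -[y](subKr x); apply: le_trans (ler_normB _ _) _.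
  by apply: le_trans xn; rewrite lerD2l (le_trans dist).
have f1 := fE t y cy nEy i.
have f2 := lP x y ltac:(by apply: le_trans xn; rewrite lerDl) yn.
have f3 := comp_le_norm (f t x - f t y) i.
have f4 : comp (f t x - f t y) i = comp (f t x) i - comp (f t y) i.
  by rewrite /Defs.comp !mxE.
have f5 : l * `|x - y| <= l * del by exact: ler_wpM2l.
have f6 : `|(A t *m (x - y)) i ord0| <= del * w by exact: mulmx_weight_le.
have f7 : (A t *m (x - y)) i ord0 =
    comp (A t *m x + b t) i - comp (A t *m y + b t) i.
  by rewrite mulmxBr /Defs.comp !mxE; ring.
have f8 : (l + w + 1) * del <= gap / 2.
  rewrite mulrC -ler_pdivlMr// ge_min; apply/orP; right.
  by rewrite le_eqVlt; apply/orP; left; apply/eqP; field; rewrite gt_eqF.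
move: f3; rewrite f4 ler_norml => /andP[_ f3].
move: f6; rewrite f7 ler_norml => /andP[f6 _].
have := le_trans f2 f5; move: f3 f8; rewrite /gap => f3 f8 f9.
have := le_trans f3 f9; move: f8 f6 f1 gap0; rewrite /gap; nra.
Qed.

End caratheodory_field.

(** * Translation invariance of the integral *)

Section translation.
Context {R : realType}.
Local Notation mu := (@lebesgue_measure R).

Lemma measurable_translation (c : R) :
  measurable_fun setT (fun x : measurableTypeR R => x + c : measurableTypeR R).
Proof. by apply: measurable_funD. Qed.

Lemma lebesgue_measure_translation (c : R) (D : set R) : measurable D ->
  pushforward mu (fun x : measurableTypeR R => x + c : measurableTypeR R) D =
  mu D.
Proof.
move=> mD.
pose mfix := isMeasurableFun.Build _ _ _ _ _ (measurable_translation c).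
pose phi : {mfun measurableTypeR R >-> measurableTypeR R} := HB.pack
  (fun x : measurableTypeR R => x + c : measurableTypeR R) mfix.
apply/esym/(@lebesgue_measure_unique R (pushforward mu phi)) => //= _ [[a b]] _ <-.
rewrite /pushforward /=.
have -> : phi @^-1` `]a, b]%classic = `]a - c, b - c]%classic.
  by apply/seteqP; split => x /=; rewrite !in_itv/= => /andP[? ?];
    apply/andP; split; lra.
rewrite !lebesgue_measure_itv/= !lte_fin ltrD2r.
by case: ifP => // _; rewrite -!EFinB; congr EFin; ring.
Qed.

Lemma sint_translation (g : R -> R) (a b c : R) : measurable_fun setT g ->
  (forall t, 0 <= g t) ->
  sint a b (fun s => g (s + c)) = sint (a + c) (b + c) g.
Proof.
move=> mg g0; rewrite /sint /Rintegral; congr fine.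
pose phi : measurableTypeR R -> measurableTypeR R := fun x => x + c.
have -> : `[a, b]%classic = phi @^-1` `[a + c, b + c].
  by apply/seteqP; split => x /=; rewrite /phi !in_itv/= => /andP[? ?];
    apply/andP; split; lra.
rewrite -[LHS](@ge0_integral_pushforward _ _ _ _ _ _ (measurable_translation c)
  mu `[a + c, b + c] (EFin \o g))//=.
- apply: eq_measure_integral => [mt Y|mt D mD _].
    exact: measurable_translation.
  exact: lebesgue_measure_translation.
- by apply: measurable_funTS; exact/measurable_EFinP.
- by move=> x _; rewrite lee_fin.
Qed.

End translation.

(** * Local integrability of the norm of [b] and its bound on unit intervals *)

Section norm_L1loc.
Context {R : realType} {N : nat}.
Local Notation mu := (@lebesgue_measure R).
Local Notation comp := Defs.comp.
Variable b : R -> 'cV[R]_N.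
Hypothesis Lb : L1loc_vec b.

Lemma vec_norm_le_sum (x : 'cV[R]_N) : `|x| <= \sum_i `|comp x i|.
Proof.
apply: vec_norm_le => [|i]; first exact: sumr_ge0.
by rewrite (bigD1 i)//= lerDl sumr_ge0.
Qed.

Lemma L1loc_vec_norm : L1loc (fun t => `|b t|).
Proof.
have [mS _ iS] := L1loc_sum (index_enum 'I_N) (fun i => L1loc_norm (Lb i)).
have mn : measurable_fun setT (fun t => `|b t|).
  rewrite (_ : (fun t => _) =
      (fun t => \big[Num.max/0]_(i : 'I_N * 'I_1) `|b t i.1 i.2|)); last first.
    by apply/funext => t; rewrite [LHS]/Num.Def.normr/= mx_normrE.
  elim: (index_enum _) => [|[i j] s IH].
    by under eq_fun do rewrite big_nil; exact: measurable_cst.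
  under eq_fun do rewrite big_cons.
  apply: measurable_maxr => //=.
  have [mb _ _] := L1loc_norm (Lb i).
  by rewrite [j]ord1.
split => //; first exact: openT.
move=> K KT cK; apply: le_lt_trans (iS K KT cK).
have mK : measurable K by exact: compact_measurable.
apply: ge0_le_integral => //=.
- apply/measurable_EFinP; apply: measurableT_comp => //.
  exact: measurable_funTS.
- apply/measurable_EFinP; apply: measurableT_comp => //.
  exact: measurable_funTS.
- move=> t _; rewrite lee_fin normr_id; apply: le_trans (ler_norm _).
  exact: vec_norm_le_sum.
Qed.

(** (A4) with [r = 1] covers the segment from [u - 1] to [u + 1], which contains [[u, w]]. *)
Lemma A4_unit_bound : A4 b -> exists M, 0 <= M /\
  forall u w, u <= w -> w <= u + 1 -> sint u w (fun t => `|b t|) <= M.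
Proof.
move=> /(_ 1 ltr01)[M MP]; exists `|M|; split => // u w uw wu.
have [mb _ _] := L1loc_vec_norm.
apply: le_trans (ler_norm M); apply: le_trans (MP u).
have := @sint_translation R (fun t => `|b t|) (-1) 1 u mb (fun=> normr_ge0 _).
rewrite {1}/sint => ->; apply: sint_subset => //; [lra|lra|].
exact: L1loc_sintegrable L1loc_vec_norm.
Qed.

End norm_L1loc.

(** * Positivity, comparison and dissipative bound for the nonlinear equation *)

Section solutions.
Context {R : realType} {N : nat}.
Local Notation mu := (@lebesgue_measure R).
Local Notation comp := Defs.comp.
Local Notation vec := 'cV[R]_N.
Variables (f : R -> vec -> vec) (A : R -> 'M[R]_N) (b : R -> vec).
Hypotheses (Lf : LC f) (a1 : A1 f) (a2 : A2 f A b).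
Implicit Types (x y : R -> vec) (s t u w : R).
Local Notation l := (mx_weight A).
Local Notation be := (fun t => `|b t|).

Let LA : L1loc_mx A := a2.1.
Let offA : forall t i j, i != j -> 0 <= A t i j := a2.2.1.
Let Lb : L1loc_vec b := a2.2.2.1.
Let Lbe : L1loc be := L1loc_vec_norm Lb.

Definition solves s t x := forall i,
  primitive_on s t (fun r => comp (f r (x r)) i) (fun r => comp (x r) i).

Lemma is_solution_solves s (x0 : vec) x : is_solution f s x0 x ->
  x s = x0 /\ forall t, s <= t -> solves s t x.
Proof.
move=> sx.
have xE t i : s <= t -> sintegrable s t (fun r => comp (f r (x r)) i) /\
    comp (x t) i = comp x0 i + sint s t (fun r => comp (f r (x r)) i).
  move=> st; have [] := sx t st i.
  by rewrite /integrable_on /oint st (min_l st) (max_r st).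
have xs : x s = x0.
  apply/matrixP => i j; rewrite [j]ord1.
  by have [_] := xE s i (lexx s); rewrite sint_refl addr0.
split => // t st i; apply: primitive_on_base; first by have [] := xE t i st.
by move=> r /andP[sr _]; rewrite xs; have [] := xE r i sr.
Qed.

Lemma solvesS s t u w x : s <= u -> w <= t -> solves s t x -> solves u w x.
Proof. by move=> su wt sx i; exact: primitive_onS (sx i). Qed.

Lemma solves_bounded s t x : solves s t x ->
  exists r, forall q, s <= q <= t -> `|x q| <= r.
Proof.
move=> sx.
apply: (@primitive_mx_bounded _ _ _ _ _ (fun q i _ => comp (f q (x q)) i)) => i j.
by rewrite [j]ord1; exact: sx.
Qed.

Lemma solves_cone s t x : s <= t -> solves s t x -> cone (x s) ->
  forall q, s <= q <= t -> cone (x q).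
Proof.
move=> st sx xs; have [r xr] := solves_bounded sx.
have [L [LL L0 lip]] := LC_lipschitz r Lf.
pose Q u w := cone (x u) -> forall q, u <= q <= w -> cone (x q).
suff : Q s t by apply.
apply: (@small_steps _ Q L (1 / 2)) => //; last first.
  move=> u v w _ uv vw _ Q1 Q2 xu q /andP[uq qw].
  have [qv|/ltW vq] := leP q v; first by apply: Q1; rewrite ?uq.
  by apply: Q2; rewrite ?vq//; apply: Q1; rewrite ?uv ?lexx.
move=> u w su uw wt L2 xu q quw i.
have iL : sintegrable u w L by exact: L1loc_sintegrable.
have i0 : sintegrable u w (fun=> 0) by exact/L1loc_sintegrable/L1loc0.
have := @ode_one_sided _ N (fun t i => - comp (x t) i)
  (fun t i => - comp (f t (x t)) i) L (fun=> 0) u w uw iL i0 L0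
  (fun=> lexx _) L2.
have -> : sint u w (fun=> 0) = 0 by rewrite /sint /Rintegral integral0.
rewrite mulr0 => H; rewrite -oppr_le0; apply: H => //.
- move=> k; apply: eq_primitive_on
    (primitive_onZ (-1) (primitive_onS su wt (sx k))).
    by move=> p _; rewrite mulN1r.
  by move=> p _; rewrite mulN1r.
- by move=> k; rewrite oppr_le0.
move=> k; apply: ae_imply (ae_and (A1_ae Lf a1) lip) => p [fp lipp].
move=> /andP[up pw] xk m m0 xm; rewrite addr0.
(* The positive part of [x p] lies on the face where (A1) applies to component [k], and its distance
   to [x p] is at most [m]. *)
pose z : vec := \col_j Num.max (comp (x p) j) 0.
have zE j : comp z j = Num.max (comp (x p) j) 0 by rewrite [LHS]mxE.
have cz : cone z by move=> j; rewrite zE le_max lexx orbT.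
have zk : comp z k = 0 by rewrite zE max_r//; lra.
have xpr : `|x p| <= r by apply: xr; rewrite (le_trans su)//= (le_trans pw).
have zr : `|z| <= r.
  apply: le_trans xpr; apply: vec_norm_le => // j; rewrite zE.
  by rewrite maxEle; case: ifP => _; [rewrite normr0|exact: comp_le_norm].
have xz : `|x p - z| <= m.
  apply: vec_norm_le => // j.
  have -> : comp (x p - z) j = comp (x p) j - comp z j by rewrite /Defs.comp !mxE.
  rewrite zE maxEle; case: ifP => h; last by rewrite subrr normr0.
  by rewrite subr0 ler0_norm.
have h1 := fp z k cz zk.
have h2 := lipp (x p) z xpr zr.
have h3 := comp_le_norm (f p (x p) - f p z) k.
have h4 : comp (f p (x p) - f p z) k = comp (f p (x p)) k - comp (f p z) k.
  by rewrite /Defs.comp !mxE.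
have h5 := ler_wpM2l (L0 p) xz.
move: h3; rewrite h4 ler_norml => /andP[h3 _].
by have := le_trans h2 h5; move: h3; rewrite mulrC; lra.
Qed.

Lemma mulmx_comp_le (M : 'M[R]_N) (v w : vec) : (forall i j, 0 <= M i j) ->
  vle v w -> vle (M *m v) (M *m w).
Proof.
move=> M0 vw i; rewrite /Defs.comp !mxE; apply: ler_sum => k _.
by rewrite ler_wpM2l//; exact: vw.
Qed.

Variable Phi : R -> 'M[R]_N.
Hypotheses (sPhi : forall a b, lin_sol A a b Phi) (Phi0 : Phi 0 = 1%:M).
Local Notation U := (transition Phi).

Let U_refl s : U s s = 1%:M.
Proof. exact: (transition_refl LA sPhi Phi0). Qed.

Let U_comp t r s : U t r *m U r s = U t s.
Proof. exact: (transition_comp LA sPhi Phi0). Qed.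

Let U_ge0 s t i j : s <= t -> 0 <= U t s i j.
Proof. exact: (transition_ge0 LA sPhi Phi0). Qed.

(** By (A2) the difference between [x] and the linear solution satisfies [v' <= A v + b].
    Off-diagonal signs permit one-sided bounds on [v], and the diagonal term is met only where its
    component is positive. *)
Lemma comparison_local u w x : u <= w -> sint u w l <= 1 / 2 ->
  solves u w x -> (forall q, u <= q <= w -> cone (x q)) ->
  vle (x w) (U w u *m x u + const_mx (2 * sint u w be)).
Proof.
move=> uw l2 sx cx i.
have il : sintegrable u w l by exact/L1loc_sintegrable/mx_weight_L1loc.
have ib : sintegrable u w be by exact: L1loc_sintegrable.
have sU : lin_sol A u w (fun t => U t u *m x u).
  exact: lin_solMr (transition_lin_sol sPhi u w u).
have := @ode_one_sided _ N (fun t i => comp (x t) i - (U t u *m x u) i ord0)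
  (fun t i => comp (f t (x t)) i - (A t *m (U t u *m x u)) i ord0) l be u w uw
  il ib (mx_weight_ge0 A) (fun=> normr_ge0 _) l2.
move=> /(_ _ _ _ w i); rewrite uw lexx => H.
rewrite /Defs.comp mxE [X in _ + X]mxE addrC -lerBlDr; apply: H => //.
- by move=> k; apply: primitive_onB (sx k) (sU k ord0).
- by move=> k; rewrite U_refl mul1mx subrr.
move=> k; apply: ae_imply (A2_ae Lf a2) => p fp pw vk m m0 vm.
have := fp _ (cx p pw) k.
have -> : comp (A p *m x p + b p) k = (A p *m x p) k ord0 + comp (b p) k.
  by rewrite /Defs.comp mxE.
have bk := le_trans (ler_norm _) (comp_le_norm (b p) k).
set z := U p u *m x u in vk vm *.
suff : (A p *m x p) k ord0 - (A p *m z) k ord0 <= m * l p.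
  by move: bk; set nb := `|b p|; lra.
apply: (@le_trans _ _ (m * \sum_q `|A p k q|)); last first.
  by rewrite ler_wpM2l// row_weight_le.
rewrite !mxE -sumrB mulr_sumr; apply: ler_sum => q _; rewrite -mulrBr mulrC.
have [->|kq] := eqVneq q k.
  apply: (@le_trans _ _ (`|x p k ord0 - z k ord0| * `|A p k k|)).
    by rewrite -normrM ler_norm.
  by rewrite ler_wpM2r// gtr0_norm//; exact: vm.
by rewrite ger0_norm ?offA 1?eq_sym// ler_wpM2r ?offA 1?eq_sym//; exact: vm.
Qed.

Lemma mulmx_const_le (M : 'M[R]_N) (c : R) i : 0 <= c ->
  comp (M *m (const_mx c : vec)) i <= N%:R * `|M| * c.
Proof.
move=> c0; apply: le_trans (ler_norm _) _; apply: le_trans (comp_le_norm _ _) _.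
apply: le_trans (mulmx_norm_le _ _) _; rewrite ler_wpM2l ?mulr_ge0//.
by apply: vec_norm_le => // j; rewrite /Defs.comp mxE ger0_norm.
Qed.

Lemma comparison K u w x : u <= w -> 0 <= K ->
  (forall s t, u <= s -> s <= t -> t <= w -> `|U t s| <= K) ->
  solves u w x -> (forall q, u <= q <= w -> cone (x q)) ->
  vle (x w) (U w u *m x u + const_mx (2 * N%:R * K * sint u w be)).
Proof.
move=> uw K0 UK sx cx.
pose C := 2 * N%:R * K.
(* Transport to a free later time [T] makes the relation transitive with additive errors; [T = w]
   returns the claim. *)
pose Q u' w' := forall T, w' <= T -> T <= w ->
  vle (U T w' *m x w') (U T u' *m x u' + const_mx (C * sint u' w' be)).
suff /(_ w (lexx _) (lexx _)) : Q u w by rewrite U_refl mul1mx.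
apply: (@small_steps _ Q l (1 / 2)) => //.
- exact: mx_weight_L1loc.
- exact: mx_weight_ge0.
- move=> u' w' uu' uw' ww' l2 T wT Tw i.
  have cx' q : u' <= q <= w' -> cone (x q).
    by move=> /andP[? ?]; apply: cx; apply/andP; split; lra.
  have := comparison_local uw' l2 (solvesS uu' ww' sx) cx'.
  have UT0 k j : 0 <= U T w' k j by exact: U_ge0.
  move=> /(mulmx_comp_le UT0)/(_ i) /le_trans; apply.
  rewrite mulmxDr mulmxA U_comp.
  have s0 : 0 <= sint u' w' be by apply: sint_ge0.
  have := @mulmx_const_le (U T w') (2 * sint u' w' be) i ltac:(by rewrite mulr_ge0).
  have UKT : `|U T w'| <= K by apply: UK => //; lra.
  rewrite /Defs.comp => h.
  rewrite mxE [X in _ <= X]mxE lerD2l; apply: le_trans h _; rewrite mxE.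
  have : N%:R * `|U T w'| * (2 * sint u' w' be) <= N%:R * K * (2 * sint u' w' be).
    by rewrite ler_wpM2r ?mulr_ge0// ler_wpM2l.
  by move/le_trans; apply; rewrite /C; lra.
move=> u1 u2 u3 _ u12 u23 u3w Q1 Q2 T T3 Tw i.
have := Q2 T T3 Tw i; have := Q1 T (le_trans u23 T3) Tw i.
rewrite /Defs.comp !mxE (sint_split (c := u2) u12 u23); last first.
  exact: L1loc_sintegrable.
by lra.
Qed.

Lemma solution_bound tau : A3 A -> A4 b -> exists al c rho, [/\ 0 < al, 0 <= c,
  0 <= rho & forall s t x, s <= t -> t <= tau -> solves s t x -> cone (x s) ->
    `|x t| <= c * expR (- al * (t - s)) * `|x s| + rho].
Proof.
move=> a3 a4; have [al [K [al0 K0 UK]]] := transition_bound LA sPhi Phi0 tau a3.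
have [M [M0 MP]] := A4_unit_bound Lb a4.
have UK1 s t : s <= t -> t <= tau -> `|U t s| <= K.
  move=> st tt; apply: le_trans (UK s t st tt) _; rewrite ler_piMr//.
  by rewrite -[leRHS]expR0 ler_expR mulNr oppr_le0 mulr_ge0 ?subr_ge0// ltW.
pose D := 2 * N%:R * K * M.
have D0 : 0 <= D by rewrite !mulr_ge0.
pose th := expR (- al).
have th1 : th < 1 by rewrite /th -[ltRHS]expR0 ltr_expR oppr_lt0.
(* The fixed point of [C = C * th + N%:R * K * D]: old errors shrink by [th] during a unit step and
   a new one is added. *)
pose C := N%:R * K * D / (1 - th).
have C0 : 0 <= C by rewrite divr_ge0 ?mulr_ge0// subr_ge0 ltW.
have CE : C * th + N%:R * K * D = C.
  by rewrite /C; field; rewrite subr_eq0 gt_eqF.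
exists al, (N%:R * K), (N%:R * K * D + C); split => //.
- by rewrite mulr_ge0.
- by rewrite addr_ge0// !mulr_ge0.
move=> s t x st ttau sx cs.
have cx := solves_cone st sx cs.
have step u w : s <= u -> u <= w -> w <= t -> w <= u + 1 ->
    vle (x w) (U w u *m x u + const_mx D).
  move=> su uw wt wu i.
  have := @comparison K u w x uw K0.
  move=> /(_ (fun p q _ pq qw => UK1 p q pq (le_trans qw (le_trans wt ttau)))).
  move=> /(_ (solvesS su wt sx)).
  have cx' q : u <= q <= w -> cone (x q).
    by move=> /andP[? ?]; apply: cx; apply/andP; split; lra.
  move=> /(_ cx' i) /le_trans; apply.
  rewrite /Defs.comp mxE [X in _ <= X]mxE lerD2l !mxE.
  by rewrite ler_wpM2l ?MP// !mulr_ge0.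
have stepU T u w : s <= u -> u <= w -> w <= t -> w <= u + 1 -> w <= T ->
    T <= tau -> forall i, comp (U T w *m x w) i <=
      comp (U T u *m x u) i + N%:R * K * D * expR (- al * (T - w)).
  move=> su uw wt wu wT Tt i.
  have UT0 k j : 0 <= U T w k j by exact: U_ge0.
  have := mulmx_comp_le UT0 (step u w su uw wt wu).
  move=> /(_ i) /le_trans; apply.
  rewrite mulmxDr mulmxA U_comp.
  have := @mulmx_const_le (U T w) D i D0.
  rewrite /Defs.comp => h.
  rewrite mxE lerD2l; apply: le_trans h _.
  have : N%:R * `|U T w| * D <= N%:R * (K * expR (- al * (T - w))) * D.
    by rewrite ler_wpM2r// ler_wpM2l// UK.
  by move/le_trans; apply; rewrite le_eqVlt; apply/orP; left; apply/eqP; ring.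
have steps (n : nat) u T : s <= u -> u + n%:R <= t -> u + n%:R <= T ->
    T <= tau -> forall i, comp (U T (u + n%:R) *m x (u + n%:R)) i <=
      comp (U T u *m x u) i + C * expR (- al * (T - (u + n%:R))).
  elim: n T => [|n IH] T su unt unT Ttau i.
    by rewrite addr0 lerDl mulr_ge0// expR_ge0.
  have n1 : u + n.+1%:R = u + n%:R + 1 :> R by rewrite -natr1 addrA.
  have n0 := ler0n R n.
  have h1 := IH T su ltac:(lra) ltac:(lra) Ttau i.
  have h2 := @stepU T (u + n%:R) (u + n.+1%:R) ltac:(lra) ltac:(lra) unt
    ltac:(lra) unT Ttau i.
  apply: le_trans h2 _; apply: le_trans (lerD h1 (lexx _)) _.
  rewrite -addrA lerD2l.
  have -> : expR (- al * (T - (u + n%:R))) =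
      th * expR (- al * (T - (u + n.+1%:R))).
    by rewrite /th -expRD n1; congr expR; ring.
  by rewrite mulrA -mulrDl CE.
pose n := Num.truncn (t - s).
have /andP[n1 n2] : n%:R <= t - s < n.+1%:R by apply: truncn_itv; lra.
move: n2; rewrite -natr1 => n2.
(* The unit steps are counted backwards from [t]; the remaining piece from [s] to [u] is shorter
   than 1 and accounts for the extra [N%:R * K * D] in the bound. *)
pose u := t - n%:R.
have un : u + n%:R = t by rewrite /u subrK.
have n0 := ler0n R n.
apply: vec_norm_le => [|i].
  by rewrite !addr_ge0// ?mulr_ge0// expR_ge0.
rewrite ger0_norm; last by apply: cx; rewrite st lexx.
have := steps n u t; rewrite un => /(_ ltac:(rewrite /u; lra) (lexx _) (lexx _) ttau i).
rewrite U_refl mul1mx subrr mulr0 expR0 mulr1 => h1.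
have := @stepU t s u (lexx _) ltac:(rewrite /u; lra) ltac:(rewrite /u; lra)
  ltac:(rewrite /u; lra) ltac:(rewrite /u; lra) ttau i.
have e1 : expR (- al * (t - u)) <= 1.
  by rewrite -[leRHS]expR0 ler_expR mulNr oppr_le0 mulr_ge0 ?(ltW al0)// /u; lra.
have e2 : N%:R * K * D * expR (- al * (t - u)) <= N%:R * K * D.
  by rewrite ler_piMr// !mulr_ge0.
have h3 : comp (U t s *m x s) i <= N%:R * K * expR (- al * (t - s)) * `|x s|.
  apply: le_trans (ler_norm _) _; apply: le_trans (comp_le_norm _ _) _.
  apply: le_trans (mulmx_norm_le _ _) _; rewrite ler_wpM2r//.
  by rewrite -mulrA ler_wpM2l// UK.
move=> h2; apply: le_trans h1 _; rewrite addrA lerD2r.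
by apply: le_trans h2 _; exact: lerD.
Qed.

Lemma solves_lipschitz s t r : s <= t -> exists G, 0 <= G /\
  forall x y, solves s t x -> solves s t y ->
    (forall q, s <= q <= t -> `|x q| <= r) ->
    (forall q, s <= q <= t -> `|y q| <= r) ->
    `|x t - y t| <= G * `|x s - y s|.
Proof.
move=> st; have [L [LL L0 lip]] := LC_lipschitz r Lf.
have [G [G0 GP]] := @gronwall R N 1 L s t LL L0 st.
exists G; split => // x y sx sy xr yr.
apply: (GP (fun q => x q - y q)); rewrite ?lexx ?st//.
split.
  exists (r + r) => q qst; apply: le_trans (ler_normB _ _) _.
  by apply: lerD; [exact: xr|exact: yr].
move=> u w M su uw wt M0 xyM p c up pc cw.
have iL v z : sintegrable v z L by exact: L1loc_sintegrable.
apply: vec_norm_le => [|i]; first by rewrite mulr_ge0// sint_ge0.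
have [ig DE] := primitive_onB (sx i) (sy i).
have -> : comp (x c - y c - (x p - y p)) i =
    (comp (x c) i - comp (y c) i) - (comp (x p) i - comp (y p) i).
  by rewrite /Defs.comp !mxE.
rewrite DE ?(le_trans su)// ?(le_trans cw)//.
have igpc := sintegrableS (le_trans su up) (le_trans cw wt) ig.
apply: le_trans (sint_norm igpc) _.
apply: (@le_trans _ _ (sint p c (fun q => M * L q))); last first.
  by rewrite sintZl// ler_wpM2l// sint_subset.
apply: ae_le_sint; [exact: sintegrable_norm|exact: sintegrableZl|].
apply: ae_imply lip => q lipq /andP[pq qc].
have quw : u <= q <= w by rewrite (le_trans up)//= (le_trans qc).
have qst : s <= q <= t.
  by have /andP[? ?] := quw; apply/andP; split; lra.
have -> : comp (f q (x q)) i - comp (f q (y q)) i =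
    comp (f q (x q) - f q (y q)) i by rewrite /Defs.comp !mxE.
apply: le_trans (comp_le_norm _ _) _.
apply: le_trans (lipq _ _ (xr q qst) (yr q qst)) _.
by rewrite mulrC ler_wpM2r// xyM.
Qed.

End solutions.

(** * The pullback attractor of an abstract process on the cone *)

Section attractor.
Context {R : realType} {N : nat}.
Local Notation vec := 'cV[R]_N.
Implicit Types (s t : R) (x y : vec) (D : set vec).

(** A cluster point of the sequence lies in every [K n], since each of these closed sets contains a
    tail. *)
Lemma nested_compact_cluster (K : nat -> set vec) (x : nat -> vec) :
  (forall n, compact (K n)) -> (forall n, K n.+1 `<=` K n) ->
  (forall n, K n (x n)) ->
  exists p, (forall n, K n p) /\ forall e, 0 < e -> exists n, `|x n - p| < e.
Proof.
move=> cK KS Kx.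
have Kle m n : (m <= n)%N -> K n `<=` K m.
  move=> /subnK <-; elim: (n - m)%N => [//|k IH] y.
  by rewrite addSn => /KS /IH.
have xK m : (x @ \oo) (K m) by exists m => // n /= mn; exact: Kle (Kx n).
have [p [Kp clp]] := cK 0%N (x @ \oo) _ (xK 0%N).
exists p; split=> [n|e e0].
  have cKn : closed (K n).
    by apply: compact_closed (cK n); exact: norm_hausdorff.
  apply: cKn => B nB; exact: clp (xK n) nB.
have := clp (range x) (ball p e) _ (nbhsx_ballx p e e0).
case; first by exists 0%N => // n _; exists n.
by move=> _ [[n _ <-]]; rewrite -ball_normE/= distrC => h; exists n.
Qed.

Variable S : R -> R -> vec -> vec.
Hypothesis S_cone : forall s t x, s <= t -> cone x -> cone (S t s x).
Hypothesis S_comp : forall s r t x, s <= r -> r <= t -> cone x ->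
  S t r (S r s x) = S t s x.
Hypothesis S_lip : forall s t rho, s <= t -> exists G, 0 <= G /\ forall x y,
  cone x -> cone y -> `|x| <= rho -> `|y| <= rho ->
  `|S t s x - S t s y| <= G * `|x - y|.
Hypothesis S_diss : forall tau, exists rho, 0 <= rho /\ forall D,
  D `<=` @cone R N -> Defs.bounded D -> exists T, 0 < T /\ forall t s, t <= tau ->
    T <= s -> forall x, D x -> `|S t (t - s) x| <= rho.

Definition cone_ball (rho : R) : set vec := [set x | cone x /\ `|x| <= rho].

Lemma cone_ball_bounded rho : Defs.bounded (cone_ball rho).
Proof. by exists rho => x []. Qed.

Lemma cone_ball_compact rho : compact (cone_ball rho).
Proof.
apply: cV_bounded_closed_compact; first exact: cone_ball_bounded.
have -> : cone_ball rho = \bigcap_i [set x : vec | 0 <= Defs.comp x i] `&`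
    [set x : vec | `|x| <= rho].
  apply/seteqP; split=> [x [cx xr]|x [cx xr]]; first by split => // i _; exact: cx.
  by split => // i; exact: cx.
apply: closedI.
  apply: closed_bigI => i _.
  apply: (@closed_comp _ _ (fun x : vec => x i ord0) [set c | 0 <= c]).
    by move=> x _; exact: coord_continuous.
  exact: closed_ge.
apply: (@closed_comp _ _ (fun x : vec => `|x|) [set c | c <= rho]).
  by move=> x _; exact: norm_continuous.
exact: closed_le.
Qed.

Lemma strong_dissipativity tau : strongly_pullback_bounded_dissipative S tau.
Proof.
have [rho rhoP] := choice S_diss.
exists (fun t => cone_ball (rho t)); split; [split|].
- move=> t; have [r0 _] := rhoP t; split; last split.
  + exists 0; split; last by rewrite normr0.
    by move=> i; rewrite /Defs.comp mxE.
  + exact: cone_ball_bounded.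
  + by move=> x [].
- move=> t D Dc Db; have [_ /(_ D Dc Db)[T [T0 TP]]] := rhoP t.
  exists T; split => // s Ts _ [x Dx <-]; split; last exact: TP.
  by apply: S_cone; [lra|exact: Dc].
- move=> D Dc Db; have [_ /(_ D Dc Db)[T [T0 TP]]] := rhoP tau.
  exists T; split => // t s tt Ts _ [x Dx <-]; split; last exact: TP.
  by apply: S_cone; [lra|exact: Dc].
Qed.

Lemma image_cone_ball_compact s t rho : s <= t ->
  compact (S t s @` cone_ball rho).
Proof.
move=> st; apply: continuous_compact; last exact: cone_ball_compact.
have [G [G0 GP]] := S_lip rho st.
apply/subspace_continuousP => x [cx xr]; apply/cvgrPdist_lt => e e0.
have G1 : 0 < G + 1 by lra.
rewrite /within /=; apply/nbhs_ballP; exists (e / (G + 1)) => /=.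
  exact: divr_gt0.
move=> y; rewrite -ball_normE/= => xy [cy yr].
apply: le_lt_trans (GP x y cx cy xr yr) _.
apply: le_lt_trans (_ : (G + 1) * `|x - y| < e); last first.
  by rewrite mulrC -ltr_pdivlMr.
by rewrite ler_wpM2r//; lra.
Qed.

Lemma attractor_exists : exists Att : R -> set vec,
  pullback_attractor S Att /\ bounded_in_the_past Att.
Proof.
have [rho0 [rho00 diss0]] := S_diss 0.
pose B0 := cone_ball rho0.
have B0c : B0 `<=` @cone R N by move=> x [].
have B0b : Defs.bounded B0 by exact: cone_ball_bounded.
pose C t s := S t s @` B0.
pose Att t := [set y | forall s, s <= t -> s <= 0 -> C t s y].
(* [T] depends on neither [t] nor [r]: dissipativity brings [D] into [B0] at the time [r], and the
   process carries it on to [t]. *)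
have absorb D : D `<=` @cone R N -> Defs.bounded D -> exists T, 0 < T /\
    forall t r s, r <= t -> r <= 0 -> s <= r - T -> S t s @` D `<=` C t r.
  move=> Dc Db; have [T [T0 TP]] := diss0 D Dc Db; exists T; split => //.
  move=> t r s rt r0 sr _ [x Dx <-]; have cx := Dc _ Dx.
  exists (S r s x); last by rewrite S_comp//; lra.
  split; first by apply: S_cone => //; lra.
  by have := TP r (r - s) r0 ltac:(lra) x Dx; rewrite subKr.
have [T0 [T00 nest]] := absorb B0 B0c B0b.
(* Starting times spaced by [T0], the waiting time after which [B0] absorbs itself, so that the sets
   [C t (sg t n)] are nested. *)
pose sg t (n : nat) := Num.min t 0 - n%:R * T0.
have sgt t n : sg t n <= t.
  have : 0 <= n%:R * T0 by rewrite mulr_ge0// ltW.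
  have : Num.min t 0 <= t by rewrite ge_min lexx.
  by rewrite /sg; lra.
have sg0 t n : sg t n <= 0.
  have : 0 <= n%:R * T0 by rewrite mulr_ge0// ltW.
  have : Num.min t 0 <= 0 by rewrite ge_min lexx orbT.
  by rewrite /sg; lra.
have sgS t n : sg t n.+1 = sg t n - T0.
  by rewrite /sg -natr1; ring.
have sg_small t (c : R) : exists n, sg t n <= c.
  pose n := Num.bound (`|Num.min t 0 - c| / T0); exists n.
  have : `|Num.min t 0 - c| / T0 < n%:R by apply: archi_boundP; rewrite divr_ge0// ltW.
  rewrite ltr_pdivrMr// => h; have := ler_norm (Num.min t 0 - c).
  by rewrite /sg; move: h; lra.
have Ccompact t n : compact (C t (sg t n)) by exact: image_cone_ball_compact.
have Cdec t n : C t (sg t n.+1) `<=` C t (sg t n).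
  by apply: nest => //; rewrite sgS.
have AttP t y : (forall n, C t (sg t n) y) -> Att t y.
  move=> Cy s st s0; have [n ns] := sg_small t (s - T0).
  exact: nest (Cy n).
have CAtt t s y : s <= t -> s <= 0 -> Att t y -> C t s y by move=> st s0; exact.
have Att_cone t : Att t `<=` @cone R N.
  move=> y Ay; have [x [cx _] <-] := CAtt t (sg t 0%N) y (sgt _ _) (sg0 _ _) Ay.
  exact: S_cone.
exists Att; split; last first.
  move=> tau; have [rho [_ diss]] := S_diss tau.
  have [T [T1 TP]] := diss B0 B0c B0b.
  exists rho => y [t /= tt Ay].
  have t0 := normr_ge0 t; have tn := ler_norm t.
  (* This starting time is at most 0 and precedes [t] by at least [T], so the radius [rho] serves
     all [t <= tau]. *)
  have [x Bx <-] := CAtt t (t - (T + `|t|)) y ltac:(lra) ltac:(lra) Ay.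
  by apply: TP => //; lra.
split; [|split; [|split]].
- move=> t; split => //.
  have -> : Att t = \bigcap_n C t (sg t n).
    apply/seteqP; split=> [y Ay n _|y Cy]; first exact: CAtt.
    by apply: AttP => n; exact: Cy.
  apply: (@subclosed_compact _ _ (C t (sg t 0%N))) => //.
    apply: closed_bigI => n _; apply: compact_closed (Ccompact t n).
    exact: norm_hausdorff.
  exact: bigcap_inf.
- move=> t s st; apply/seteqP; split.
    move=> _ [a Aa <-] r rt r0.
    (* Before [s], so that [a] comes from [B0] at [r']; before [r - T0], so that nesting leads into
       [C t r]. *)
    pose r' := Num.min (r - T0) s.
    have r'r : r' <= r - T0 by rewrite ge_min lexx.
    have r's : r' <= s by rewrite ge_min lexx orbT.
    have [x Bx xa] := CAtt s r' a r's ltac:(lra) Aa.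
    apply: (nest t r r') => //; exists x => //.
    by rewrite -xa S_comp//; exact: B0c.
  move=> y Ay.
  (* [c n] is the position at time [s] of a trajectory from [B0] that ends at [y]. A cluster point
     lies in [Att s] and is mapped to [y] by continuity. *)
  have /choice[c cP] n : exists c, C s (sg s n) c /\ S t s c = y.
    have [x Bx xy] := CAtt t (sg s n) y (le_trans (sgt s n) st) (sg0 s n) Ay.
    exists (S s (sg s n) x); split; first by exists x.
    by rewrite S_comp//; exact: B0c.
  have [p [Cp pP]] := nested_compact_cluster (Ccompact s) (Cdec s)
    (fun n => (cP n).1).
  have Ap : Att s p by exact: AttP.
  exists p => //.
  have [M MP] : Defs.bounded (C s (sg s 0%N)).
    have [M [_ MP]] := compact_bounded (Ccompact s 0%N).
    exists (M + 1) => x Cx; apply: MP Cx; lra.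
  have Cn0 n : C s (sg s n) `<=` C s (sg s 0%N).
    by elim: n => [//|n IH] z /Cdec /IH.
  have [G [G0 GP]] := S_lip M st.
  apply/eqP; rewrite eq_sym -subr_eq0 -normr_le0 leNgt; apply/negP => h0.
  have G1 : 0 < G + 1 by lra.
  have [n nP] := pP (`|y - S t s p| / (G + 1)) ltac:(exact: divr_gt0).
  have [Cn cny] := cP n.
  have cc : cone (c n) by case: Cn => x [cx _] <-; exact: S_cone.
  have h1 : `|S t s (c n) - S t s p| <= G * `|c n - p|.
    apply: GP => //; first exact: Att_cone Ap.
    - exact/MP/(Cn0 n).
    - exact/MP/Cp.
  move: h1; rewrite cny => h1.
  move: nP; rewrite ltr_pdivlMr// => nP.
  have := normr_ge0 (c n - p); move: h1 nP.
  by set z := `|y - _|; set w := `|_ - p|; nra.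
- move=> t D Dc Db e e0.
  have [T [T1 TP]] := absorb D Dc Db.
  have [n nP] : exists n, forall y, C t (sg t n) y ->
      exists2 a, Att t a & `|y - a| <= e.
    (* Otherwise points of the nested sets that stay farther than [e] from [Att t] would cluster at
       a point of [Att t]. *)
    apply: contrapT => /forallNP h.
    have /choice[x xP] n : exists y, C t (sg t n) y /\
        forall a, Att t a -> e < `|y - a|.
      have /existsNP[y /not_implyP[Cy ny]] := h n; exists y; split => // a Aa.
      by rewrite ltNge; apply/negP => ya; apply: ny; exists a.
    have [p [Cp pP]] := nested_compact_cluster (Ccompact t) (Cdec t)
      (fun n => (xP n).1).
    have [n nP] := pP e e0.
    by have := (xP n).2 p (AttP t p Cp); rewrite ltNge ltW.
  exists (sg t n - T) => s ss st; apply: ge_ereal_sup => _ [y Sy <-].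
  have [a Aa ya] := nP y (TP t (sg t n) s (sgt _ _) (sg0 _ _) ss y Sy).
  apply: (@le_trans _ _ `|y - a|%:E); last by rewrite lee_fin.
  by apply: ereal_inf_lbound; exists a.
- move=> Cc Ccc attr t a Aa; have [clC _] := Ccc t.
  apply: clC => B /nbhs_ballP[e /= e0 eB].
  have e20 : 0 < e / 2 by exact: divr_gt0.
  have [s0 sP] := attr t B0 B0c B0b _ e20.
  (* Early enough for [Cc] to attract [B0] within [e / 2] and for [a] to lie in [C t s]. *)
  pose s := Num.min s0 (Num.min t 0).
  have ss0 : s <= s0 by rewrite ge_min lexx.
  have st : s <= t by rewrite /s !ge_min lexx orbT.
  have s00 : s <= 0 by rewrite /s !ge_min lexx !orbT.
  have := sP s ss0 st => h.
  have : (ereal_inf [set `|a - y|%:E | y in Cc t] < e%:E)%E.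
    apply: (@le_lt_trans _ _ (e / 2)%:E); last by rewrite lte_fin; lra.
    apply: le_trans h; apply: ereal_sup_ubound; exists a => //.
    exact: CAtt.
  move=> /ereal_inf_lt[_ [y Cy <-]]; rewrite lte_fin => ay.
  by exists y; split => //; apply: eB; rewrite -ball_normE.
Qed.

End attractor.

Theorem theorem6p12 (R : realType) (N : nat)
  (f : R -> 'cV[R]_N -> 'cV[R]_N) (A : R -> 'M[R]_N) (b : R -> 'cV[R]_N)
  (S : R -> R -> 'cV[R]_N -> 'cV[R]_N) :
  LC f -> A1 f -> A2 f A b -> A3 A -> A4 b ->
  is_solution_process f S ->
  (forall tau : R, strongly_pullback_bounded_dissipative S tau) /\
  exists Att : R -> set 'cV[R]_N,
    pullback_attractor S Att /\ bounded_in_the_past Att.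
Proof.
move=> Lf a1 a2 a3 a4 sS.
have [Phi [sPhi Phi0]] := fundamental_exists a2.1.
have bound tau := solution_bound Lf a1 a2 sPhi Phi0 tau a3 a4.
have Ss s x : cone x -> S s s x = x.
  by move=> cx; have [] := is_solution_solves (sS s x cx).
have Ssol s t x : cone x -> s <= t -> solves f s t (fun r => S r s x).
  by move=> cx; have [_] := is_solution_solves (sS s x cx); exact.
have S_cone s t x : s <= t -> cone x -> cone (S t s x).
  move=> st cx.
  apply: (solves_cone Lf a1 st (Ssol s t x cx st)); rewrite ?Ss// st lexx//.
have S_comp s r t x : s <= r -> r <= t -> cone x ->
    S t r (S r s x) = S t s x.
  move=> sr rt cx; have cr := S_cone s r x sr cx.
  have s1 := Ssol r t _ cr rt.
  have s2 := solvesS sr (lexx t) (Ssol s t x cx (le_trans sr rt)).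
  have [r1 r1P] := solves_bounded s1; have [r2 r2P] := solves_bounded s2.
  (* Both sides solve the equation on [[r, t]] from the same state at [r], within a common radius;
     uniqueness follows. *)
  have [G [G0 /(_ _ _ s1 s2)]] := solves_lipschitz Lf (Num.max r1 r2) rt.
  rewrite Ss// subrr normr0 mulr0 normr_le0 subr_eq0 => h.
  apply/eqP/h => q qrt; rewrite le_max.
    by rewrite r1P.
  by rewrite r2P ?orbT.
have S_lip s t rho : s <= t -> exists G, 0 <= G /\ forall x y,
    cone x -> cone y -> `|x| <= rho -> `|y| <= rho ->
    `|S t s x - S t s y| <= G * `|x - y|.
  move=> st; have [al [c [rh [al0 c0 rh0 bP]]]] := bound t.
  (* The dissipative estimate without its decay is an a priori bound, which fixes the ball for the
     Lipschitz estimate. *)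
  pose r := c * rho + rh.
  have Sr x : cone x -> `|x| <= rho -> forall q, s <= q <= t -> `|S q s x| <= r.
    move=> cx xr q /andP[sq qt].
    have := bP s q _ sq qt (Ssol s q x cx sq); rewrite Ss// => /(_ cx) h.
    apply: le_trans h _; rewrite lerD2r -mulrA ler_wpM2l//.
    apply: le_trans xr; rewrite ler_piMl//.
    by rewrite -[leRHS]expR0 ler_expR mulNr oppr_le0 mulr_ge0 ?subr_ge0 ?(ltW al0).
  have [G [G0 GP]] := solves_lipschitz Lf r st.
  exists G; split => // x y cx cy xr yr.
  have := GP _ _ (Ssol s t x cx st) (Ssol s t y cy st) (Sr x cx xr) (Sr y cy yr).
  by rewrite !Ss.
have S_diss tau : exists rho, 0 <= rho /\ forall D,
    D `<=` @cone R N -> Defs.bounded D -> exists T, 0 < T /\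
    forall t s, t <= tau -> T <= s -> forall x, D x -> `|S t (t - s) x| <= rho.
  have [al [c [rh [al0 c0 rh0 bP]]]] := bound tau.
  exists (1 + rh); split; first exact: addr_ge0.
  move=> D Dc [M DM]; pose m := c * `|M|.
  have m0 : 0 <= m by rewrite mulr_ge0.
  (* From [s >= m / al] follows [m <= al * s <= expR (al * s)], so the initial state contributes at
     most 1; the summand [1] makes the time positive. *)
  exists (m / al + 1); split; first by rewrite ltr_wpDl// divr_ge0// ltW.
  move=> t s tt Ts x Dx; have cx := Dc x Dx.
  have s0 : 0 <= s by apply: le_trans Ts; rewrite addr_ge0// divr_ge0// ltW.
  have st : t - s <= t by rewrite gerBl.
  have := bP _ _ _ st tt (Ssol _ _ x cx st); rewrite Ss// => /(_ cx) h.
  apply: le_trans h _; rewrite lerD2r subKr.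
  apply: (@le_trans _ _ (m * expR (- al * s))).
    rewrite /m mulrAC ler_wpM2r ?expR_ge0// ler_wpM2l//.
    exact: le_trans (DM x Dx) (ler_norm M).
  have ms : m <= al * s.
    have : al * (m / al + 1) <= al * s by rewrite ler_pM2l.
    by rewrite mulrDr mulr1 mulrCA mulfV ?gt_eqF// mulr1; lra.
  rewrite mulNr expRN ler_pdivrMr ?expR_gt0// mul1r.
  by apply: le_trans ms _; apply: le_trans (expR_ge1Dx _); rewrite lerDr.
split; first exact: strong_dissipativity.
exact: attractor_exists.
Qed.
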